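(* For all real numbers $c, \varepsilon > 0$ there exists $n_0 = n_0(c,\varepsilon)$ such that the following holds. If $G$ is a graph on $n \ge n_0$ vertices with $\Delta(G) \ge cn$, then $\chi_s(G) \le (2+\varepsilon)\Delta(G)$, i.e. $G$ is strongly $r$-colourable for some positive integer $r \le (2+\varepsilon)\Delta(G)$.
   Context: Let $r$ be a positive integer and $G$ a graph on $n$ vertices. If $r$ divides $n$, $G$ is strongly $r$-colourable if for every partition $\{V_1,\dots,V_k\}$ of $V(G)$ into classes of size $r$ there is a proper vertex colouring of $G$ with $r$ colours in which every $V_i$ receives all $r$ colours. If $r$ does not divide $n$, $G$ is strongly $r$-colourable if the graph obtained from $G$ by adding $r\lceil n/r\rceil - n$ isolated vertices is strongly $r$-colourable. The strong chromatic number $\chi_s(G)$ is the minimum $r$ such that $G$ is strongly $r$-colourable. $\Delta(G)$ is the maximum degree of $G$. *)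

(* Defs.v *)
From Stdlib Require Import Reals.
From mathcomp Require Import all_boot.

Set Implicit Arguments.
Unset Strict Implicit.
Unset Printing Implicit Defensive.

Definition simple_graph (V : finType) (e : rel V) : Prop :=
  symmetric e /\ irreflexive e.

Definition degree (V : finType) (e : rel V) (x : V) : nat := #|[set y | e x y]|.
Definition max_degree (V : finType) (e : rel V) : nat :=
  \max_(x : V) degree e x.

Definition strongly_col_div (V : finType) (e : rel V) (r : nat) : Prop :=
  forall P : {set {set V}},
    partition P [set: V] ->
    {in P, forall B : {set V}, #|B| = r} ->
    exists f : V -> 'I_r,
      (forall x y : V, e x y -> f x != f y) /\
      {in P, forall B : {set V}, forall i : 'I_r, exists2 x, x \in B & f x = i}.

Definition pad_rel (V : finType) (e : rel V) (k : nat) : rel (V + 'I_k)%type :=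
  fun a b => match a, b with inl x, inl y => e x y | _, _ => false end.
Arguments pad_rel : clear implicits.

(* r * ceil(n / r) - n, for r > 0 (ceil(n/r) = (n + r - 1) / r) *)
Definition pad_count (n r : nat) : nat := r * ((n + r.-1) %/ r) - n.

Definition strongly_colourable (V : finType) (e : rel V) (r : nat) : Prop :=
  if r %| #|V| then strongly_col_div e r
  else strongly_col_div (pad_rel V e (pad_count #|V| r)) r.

(* Main.v *)
Require Import Defs.
From Stdlib Require Import Reals Lra.
From mathcomp Require Import all_boot all_order all_algebra zify ring lra.

(** Put r = 2D + q with q a small proportion of the maximum degree D.  There
    are boundedly many classes V_i of size r, and a colouring is a tiling of
    the vertex set by independent transversals (ITs) of the classes.
    - Haxell's local search gives an IT whenever r >= 2D, and its obstruction
      gives, by lowering weights, the weighted form of Aharoni, Berger and Ziv: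
      for every weight w some IT T satisfies w(T) >= w(V)/r.
    - The weighted form acts as a derandomized "random IT with uniform
      marginals".  Such an IT meets N(x) \cup N(y) fewer than
      (d(x) + d(y))/r <= 1 - q/r times on average, so it links x to y with
      positive probability; this yields absorbers, of which a linear number
      can be chosen so that every transversal Z is absorbed by many of them.
    - Removing ITs one by one while a fourth-moment potential keeps the degrees
      into the remaining set proportional to its size tiles all but a small
      proportion of the remaining vertices; the absorbers take the rest. *)

Set Implicit Arguments.
Unset Strict Implicit.
Unset Printing Implicit Defensive.
Import Order.TTheory GRing.Theory Num.Theory.

(** * Independent transversals *)

(* Lexicographic order on sequences bounded by [B]; missing entries count as [B],
   so that appending an entry below [B] lowers the rank. *)
Fixpoint lexrank (B n : nat) (s : seq nat) : nat :=
  if n is n'.+1 then head B s * B.+1 ^ n' + lexrank B n' (behead s) else 0.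

Lemma lexrank_bound B n s : all (leq^~ B) s -> lexrank B n s < B.+1 ^ n.
Proof.
elim: n s => [|n IHn] s //= hs.
have hh : head B s <= B by case: s hs => //= x s /andP[].
have ht : all (leq^~ B) (behead s) by case: s hs {hh} => //= x s /andP[].
have := IHn _ ht; rewrite expnS => h.
by apply: leq_trans (_ : head B s * B.+1 ^ n + B.+1 ^ n <= _);
  [rewrite ltn_add2l | rewrite addnC -mulSn leq_mul2r ltnS hh orbT].
Qed.

(** By [lexrank_bound] a whole tail weighs less than one unit of the entry before it, so lowering an
    entry wins whatever follows. *)
Lemma lexrank_lt B n (p q q' : seq nat) x y :
  size p < n -> all (leq^~ B) q' -> y < x ->
  lexrank B n (p ++ y :: q') < lexrank B n (p ++ x :: q).
Proof.
elim: p n => [|z p IHp] [|n] //= hn hq hyx; last by rewrite ltn_add2l IHp.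
have := lexrank_bound n hq.
have : y.+1 * B.+1 ^ n <= x * B.+1 ^ n by rewrite leq_mul2r hyx orbT.
by rewrite mulSn; lia.
Qed.

Lemma lexrank_rcons B n s : lexrank B n (rcons s B) = lexrank B n s.
Proof.
by elim: n s => [|n IHn] [|x s] //=; rewrite IHn.
Qed.

Section Haxell.
Variables (V I : finType) (e : rel V) (b : V -> I).
Hypotheses (es : symmetric e) (ei : irreflexive e).

Definition nbhd (x : V) : {set V} := [set y | e x y].

Definition indep_transversal (T : {ffun I -> V}) : bool :=
  [forall i, b (T i) == i] && [forall i, forall j, ~~ e (T i) (T j)].

Lemma transversal_block (T : {ffun I -> V}) i : indep_transversal T -> b (T i) = i.
Proof. by case/andP=> /forallP/(_ i)/eqP. Qed.

Definition partial_transversal (W M : {set V}) : bool :=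
  [&& M \subset W, [forall x in M, forall y in M, (b x == b y) ==> (x == y)]
    & [forall x in M, forall y in M, ~~ e x y]].

Lemma partial_transversalP (W M : {set V}) :
  reflect [/\ M \subset W, {in M &, injective b} & {in M &, forall x y, ~~ e x y}]
          (partial_transversal W M).
Proof.
apply: (iffP and3P) => -[h1 h2 h3]; split=> //.
- move=> x y xM yM bxy; move/forall_inP/(_ _ xM)/forall_inP/(_ _ yM): h2.
  by rewrite bxy eqxx => /eqP.
- by move=> x y xM yM; move/forall_inP/(_ _ xM)/forall_inP/(_ _ yM): h3.
- apply/forall_inP=> x xM; apply/forall_inP=> y yM; apply/implyP=> /eqP bxy.
  by apply/eqP; apply: h2.
- by apply/forall_inP=> x xM; apply/forall_inP=> y yM; apply: h3.
Qed.

(* The state of the search: [cs] lists the centres of stars whose leaves are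
   their neighbours in [M]; a new centre lies in a block already reached from
   the uncovered block [i0] and has no neighbour among earlier centres and
   leaves. *)
Definition leaves (M : {set V}) (p : seq V) : {set V} := [set x in M | has (e x) p].

Definition admissible (i0 : I) (W M : {set V}) (p : seq V) (v : V) : Prop :=
  [/\ v \in W, b v \in i0 |: b @: leaves M p
    & forall x, (x \in p) || (x \in leaves M p) -> ~~ e v x].

Definition centres_ok (i0 : I) (W M : {set V}) (cs : seq V) : Prop :=
  forall p v q, cs = p ++ v :: q -> admissible i0 W M p v.

Lemma centres_ok_prefix i0 W M p q :
  centres_ok i0 W M (p ++ q) -> centres_ok i0 W M p.
Proof. by move=> h p' v q' E; apply: (h p' v (q' ++ q)); rewrite E -catA. Qed.

(** With two centres adjacent to [l], [l] was already a leaf when the later of them was chosen, and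
    a new centre must not be adjacent to a leaf. So the stars have disjoint leaf sets. *)
Lemma leaves_unique_centre i0 W M cs l p c q :
  centres_ok i0 W M cs -> cs = p ++ c :: q -> l \in M -> e l c ->
  forall x, x \in p ++ q -> ~~ e l x.
Proof.
move=> ok E lM lc x; rewrite mem_cat => /orP[] xin; apply/negP=> lx.
  have [_ _ H] := ok _ _ _ E; suff: ~~ e c l by rewrite es lc.
  by apply: H; rewrite inE lM; apply/orP; right; apply/hasP; exists x.
case/splitPr: xin E => q1 q2 E.
have [_ _ H] := ok (p ++ c :: q1) x q2 (etrans E (catA p (c :: q1) (x :: q2))).
suff: ~~ e x l by rewrite es lx.
apply: H; rewrite inE lM; apply/orP; right; apply/hasP; exists c => //.
by rewrite mem_cat mem_head orbT.
Qed.

Lemma leaves_rcons M cs v : leaves M (rcons cs v) = leaves M cs :|: (nbhd v :&: M).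
Proof.
by apply/setP=> x; rewrite !inE has_rcons es; case: (x \in M); rewrite ?andbF ?andbT // orbC.
Qed.

(** A new centre has a neighbour in [M], which cannot be an earlier leaf, so every centre
    contributes a leaf of its own. *)
Lemma size_centres i0 W M cs :
  centres_ok i0 W M cs -> {in cs, forall v, nbhd v :&: M != set0} ->
  size cs <= #|leaves M cs|.
Proof.
elim/last_ind: cs => [|cs v IH] //= ok hit.
have ok' : centres_ok i0 W M cs by apply: (@centres_ok_prefix _ _ _ _ [:: v]); rewrite cats1.
have {}IH : size cs <= #|leaves M cs|.
  by apply: IH => // x xin; apply: hit; rewrite mem_rcons inE xin orbT.
have /set0Pn[x] : nbhd v :&: M != set0 by apply: hit; rewrite mem_rcons mem_head.
rewrite size_rcons leaves_rcons inE => /andP[vx xM].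
apply: (leq_ltn_trans IH); apply/proper_card/properP; split; first exact: subsetUl.
exists x; first by rewrite !inE xM -[e v x]inE vx orbT.
have [_ _ H] := ok cs v [::] (esym (cats1 _ _)).
rewrite inE in vx; apply/negP=> xl; suff: ~~ e v x by rewrite vx.
by apply: H; rewrite xl orbT.
Qed.

Lemma size_centres_lt i0 W M cs :
  partial_transversal W M -> i0 \notin b @: M ->
  centres_ok i0 W M cs -> {in cs, forall v, nbhd v :&: M != set0} ->
  size cs < #|I|.
Proof.
move=> /partial_transversalP[_ binj _] i0M ok hit.
apply: (leq_ltn_trans (size_centres ok hit)).
have le1 : #|leaves M cs| <= #|M|.
  by apply/subset_leq_card/subsetP => x; rewrite inE => /andP[].
apply: (leq_ltn_trans le1); rewrite -(card_in_imset binj) -cardsT.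
apply/proper_card/properP; split; first exact: subsetT.
by exists i0; rewrite ?inE.
Qed.

Definition hit_sizes (M : {set V}) (cs : seq V) := [seq #|nbhd v :&: M| | v <- cs].

(** The exchange step: [v] has no neighbour in [M], so it can take the place of the leaf [l] of its
    block. Neither [v] nor [l] is adjacent to a centre before [c], so the earlier stars are
    unchanged, while [c] loses [l]. *)
Lemma swap_leaf i0 W M p c q v l :
  partial_transversal W M -> i0 \notin b @: M ->
  centres_ok i0 W M (rcons (p ++ c :: q) v) -> nbhd v :&: M = set0 ->
  l \in M -> e l c -> b v = b l ->
  let M' := v |: (M :\ l) in
  [/\ partial_transversal W M', #|M'| = #|M|, i0 \notin b @: M',
      centres_ok i0 W M' (rcons p c)
    & {in p, forall x, nbhd x :&: M' = nbhd x :&: M} /\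
      #|nbhd c :&: M'| < #|nbhd c :&: M|].
Proof.
move=> /partial_transversalP[MW binj ind] i0M ok nov lM lc bvl M'.
set cs := p ++ c :: q in ok.
have [vW vS vund] := ok cs v [::] (esym (cats1 _ _)).
have okc : centres_ok i0 W M cs by apply: (@centres_ok_prefix _ _ _ _ [:: v]); rewrite cats1.
have nvM x : x \in M -> ~~ e v x.
  move=> xM; apply/negP=> vx; have : x \in nbhd v :&: M by rewrite !inE vx xM.
  by rewrite nov inE.
have vM : v \notin M.
  apply/negP=> vM; have vl : v = l by apply: binj.
  by have := vund c; rewrite mem_cat mem_head orbT vl lc => /(_ isT).
have nvp x : x \in cs -> ~~ e v x by move=> xp; apply: vund; rewrite xp.
have nlp x : x \in p -> ~~ e l x.
  by move=> xp; apply: (leaves_unique_centre okc (erefl _) lM lc); rewrite mem_cat xp.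
have lv p' : {subset p' <= p} -> leaves M' p' = leaves M p'.
  move=> sub; apply/setP=> x; rewrite !inE; apply: andb_id2r => /hasP[y /sub yp xy].
  have -> : x == v = false.
    by apply/eqP=> E; rewrite E in xy; move: xy; apply/negP/nvp; rewrite mem_cat yp.
  have -> // : x != l.
  by apply/eqP=> E; rewrite E in xy; move: xy; apply/negP/nlp.
split.
- apply/partial_transversalP; split.
  + apply/subsetP=> x; rewrite !inE => /orP[/eqP-> //|/andP[_ xM]].
    exact: (subsetP MW).
  + have aux x : x \in M -> x != l -> b v <> b x.
      by move=> xM /eqP xl bvx; apply: xl; apply: binj => //; rewrite -bvx.
    move=> x y; rewrite !inE => /orP[/eqP->|/andP[xl xM]] /orP[/eqP->|/andP[yl yM]] //.
    * by move=> /(aux _ yM yl).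
    * by move=> /esym /(aux _ xM xl).
    * exact: binj.
  + move=> x y; rewrite !inE => /orP[/eqP->|/andP[xl xM]] /orP[/eqP->|/andP[yl yM]].
    * by rewrite ei.
    * exact: nvM.
    * by rewrite es nvM.
    * exact: ind.
- by rewrite cardsU1 !inE (negPf vM) andbF /= [in RHS](cardsD1 l) lM.
- apply: contra i0M => /imsetP[x]; rewrite !inE => /orP[/eqP->|/andP[_ xM]] ->.
    by rewrite bvl imset_f.
  exact: imset_f.
- move=> p' v' q' E.
  have [r E2] : exists r, p = p' ++ r.
    case/lastP: q' E => [|q' z] E.
      by exists [::]; rewrite cats0; move: E; rewrite cats1 => /rcons_inj[].
    by exists (v' :: q'); move: E; rewrite -rcons_cons -rcons_cat => /rcons_inj[].
  have E3 : exists r, cs = p' ++ v' :: r.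
    exists (q' ++ q); rewrite /cs -cat_rcons E -catA //.
  have [r3 {}E3] := E3; have := okc _ _ _ E3.
  by rewrite /admissible lv // => x xp'; rewrite E2 mem_cat xp'.
split.
- move=> x xp; apply/setP=> y; rewrite !inE.
  apply: andb_id2l => xy; have -> : y == v = false.
    by apply/eqP=> E; rewrite E es in xy; move: xy; apply/negP/nvp; rewrite mem_cat xp.
  have -> // : y != l.
  by apply/eqP=> E; rewrite E es in xy; move: xy; apply/negP/nlp.
- apply/proper_card/properP; split.
    apply/subsetP=> y; rewrite !inE => /andP[cy /orP[/eqP E|/andP[_ ->]]]; last by rewrite cy.
    by have := nvp c; rewrite mem_cat mem_head orbT -E es cy => /(_ isT).
  exists l; first by rewrite !inE es lc lM.
  rewrite !inE eqxx orbF negb_and; apply/orP; right; apply/eqP=> E.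
  by rewrite E (negPf vM) in lM.
Qed.

(** Induction on the rank of the star sizes, which drops both when an undominated vertex becomes a
    new centre and when [swap_leaf] shrinks a star and truncates the list. Only the last centre may
    be without leaves. *)
Lemma haxell_search i0 W M cs m :
  (forall M', partial_transversal W M' -> #|M'| <= m) ->
  partial_transversal W M -> #|M| = m -> i0 \notin b @: M ->
  centres_ok i0 W M cs ->
  (forall p v q, cs = p ++ v :: q -> q != [::] -> nbhd v :&: M != set0) ->
  exists M' cs', [/\ partial_transversal W M', i0 \notin b @: M',
    centres_ok i0 W M' cs', {in cs', forall v, nbhd v :&: M' != set0}
    & forall v, v \in W -> b v \in i0 |: b @: leaves M' cs' ->
       exists2 x, (x \in cs') || (x \in leaves M' cs') & e v x].
Proof.
move=> maxm.
have [n] := ubnP (lexrank #|V| #|I| (hit_sizes M cs)).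
elim: n M cs => // n IH M cs; rewrite ltnS => rk PM Mm i0M ok hit.
have [allhit|] := boolP (all (fun v => nbhd v :&: M != set0) cs).
  move/allP in allhit.
  pose dom v := [exists x, ((x \in cs) || (x \in leaves M cs)) && e v x].
  have [H|] := boolP [forall v in W, (b v \in i0 |: b @: leaves M cs) ==> dom v].
    exists M, cs; split=> // v vW vS.
    move/forall_inP/(_ _ vW)/implyP/(_ vS)/existsP: H => [x /andP[xin vx]].
    by exists x.
  rewrite negb_forall_in => /exists_inP[v vW]; rewrite negb_imply => /andP[vS nd].
  apply: (IH M (rcons cs v)) => //.
  (* The missing entry counts as [#|V|]; the star of [v] is smaller because [v] is not its own
     neighbour. *)
  - apply: leq_trans rk; rewrite /hit_sizes map_rcons -(lexrank_rcons _ _ [seq _ | _ <- cs]).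
    rewrite -!cats1; apply: lexrank_lt => //.
      by rewrite size_map; apply: size_centres_lt PM i0M ok allhit.
    rewrite -cardsT; apply/proper_card/properP; split; first exact: subsetT.
    by exists v; rewrite ?inE // ei.
  - move=> p v' q E; case/lastP: q E => [|q z].
      rewrite cats1 => /rcons_inj[<- <-]; split=> // x xin.
      by apply: contra nd => vx; apply/existsP; exists x; rewrite xin vx.
    by rewrite -rcons_cons -rcons_cat => /rcons_inj[E _]; apply: ok E.
  - move=> p v' q E; case/lastP: q E => // q z.
    rewrite -rcons_cons -rcons_cat => /rcons_inj[E _] _; apply: allhit.
    by rewrite E mem_cat mem_head orbT.
rewrite -has_predC => /hasP[v0 v0cs /= /negPn nov].
have [p0 E] : exists p0, cs = rcons p0 v0.
  case/splitPr: v0cs hit => p q hit; exists p.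
  have [->|q0] := eqVneq q [::]; first by rewrite cats1.
  by have := hit _ _ _ (erefl _) q0; rewrite nov.
move/eqP in nov.
have [vW vS vund] := ok p0 v0 [::] (etrans E (esym (cats1 _ _))).
have hit0 : {in p0, forall v, nbhd v :&: M != set0}.
  move=> v vp; case/splitPr: vp E => p q E; apply: (hit p v (rcons q v0)).
    by rewrite E rcons_cat.
  by case: (q).
(* A last centre in the uncovered block [i0] could be added to [M], against the maximality of
   [m]. *)
have vM : v0 \notin M -> b v0 = i0 -> False.
  move=> vM bv; have /maxm : partial_transversal W (v0 |: M).
    move/partial_transversalP: PM => [MW binj ind]; apply/partial_transversalP.
    have nvM x : x \in M -> ~~ e v0 x.
      move=> xM; apply/negP=> vx; have : x \in nbhd v0 :&: M by rewrite !inE vx xM.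
      by rewrite nov inE.
    have aux x : x \in M -> b v0 <> b x.
      by move=> xM bvx; move/negP: i0M; apply; rewrite -bv bvx imset_f.
    split.
    - by rewrite subUset sub1set vW.
    - move=> x y; rewrite !inE => /orP[/eqP->|xM] /orP[/eqP->|yM] //.
      + by move=> /(aux _ yM).
      + by move=> /esym/(aux _ xM).
      + exact: binj.
    - move=> x y; rewrite !inE => /orP[/eqP->|xM] /orP[/eqP->|yM].
      + by rewrite ei.
      + exact: nvM.
      + by rewrite es nvM.
      + exact: ind.
  by rewrite cardsU1 vM Mm ltnn.
move: vS; rewrite 2!inE => /orP[/eqP bv|/imsetP[l]].
  exfalso; apply: vM => //; apply/negP=> v0M; move/negP: i0M; apply.
  by rewrite -bv imset_f.
rewrite inE => /andP[lM /hasP[c cp0 lc]] bvl.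
case/splitPr: cp0 => p q in E hit0 vund *.
rewrite E in ok rk.
have [PM' cM' i0M' ok' [same less]] := swap_leaf PM i0M ok nov lM lc bvl.
set M' := v0 |: (M :\ l) in PM' cM' i0M' ok' same less.
apply: (IH M' (rcons p c)) => //.
- apply: leq_trans rk; rewrite /hit_sizes map_rcons -cats1 rcons_cat map_cat /=.
  have -> : [seq #|nbhd v :&: M'| | v <- p] = [seq #|nbhd v :&: M| | v <- p].
    by apply/eq_in_map => x xp; rewrite same.
  apply: lexrank_lt => //.
  rewrite size_map; apply: (@size_centres_lt i0 W M) => //.
    by apply: (@centres_ok_prefix _ _ _ _ (rcons (c :: q) v0)); rewrite -rcons_cat.
  by move=> x xp; apply: hit0; rewrite mem_cat xp.
- by rewrite cM'.
- move=> p' v' q' E'; case/lastP: q' E' => // q' z.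
  rewrite -rcons_cons -rcons_cat => /rcons_inj[E' _] _.
  have vp : v' \in p by rewrite E' mem_cat mem_head orbT.
  by rewrite same //; apply: hit0; rewrite mem_cat vp.
Qed.

(** A maximum partial transversal in [W] that misses a block [i0] starts the search there; the final
    centres and leaves are [C] and [L]. [S] holds the blocks of the leaves and [i0], hence
    [#|L| < #|S|]. *)
Lemma transversal_or_dominated (W : {set V}) :
  (exists2 T : {ffun I -> V}, indep_transversal T & forall i, T i \in W) \/
  (exists S : {set I}, exists L C : {set V},
    [/\ L \subset W, C \subset W, #|C| <= #|L| & #|L| < #|S|] /\
    [/\ {in L, forall l, b l \in S}, {in L &, injective b},
       {in L &, forall x y, ~~ e x y}, {in L, forall l, #|nbhd l :&: C| = 1}
     & forall v, v \in W -> b v \in S -> exists2 x, x \in C :|: L & e v x]).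
Proof.
have P0 : partial_transversal W set0.
  apply/partial_transversalP; split; first exact: sub0set.
    by move=> x y; rewrite inE.
  by move=> x y; rewrite inE.
case: (arg_maxnP (fun M : {set V} => #|M|) P0) => M PM maxM.
have [full|] := boolP [forall i, i \in b @: M].
  left; move/partial_transversalP: PM => [MW binj ind].
  have ex i : exists x, (x \in M) && (b x == i).
    by move/forallP/(_ i)/imsetP: full => [x xM ->]; exists x; rewrite xM /=.
  pose T := [ffun i => xchoose (ex i)].
  have TP i : T i \in M /\ b (T i) = i.
    by rewrite ffunE; have /andP[? /eqP ?] := xchooseP (ex i).
  exists T; last by move=> i; apply: (subsetP MW); case: (TP i).
  apply/andP; split; apply/forallP=> i; first by apply/eqP; case: (TP i).
  by apply/forallP=> j; apply: ind; [case: (TP i) | case: (TP j)].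
rewrite negb_forall => /existsP[i0 i0M]; right.
have [||M' [cs [PM' i0M' ok hit dom]]] :=
    @haxell_search i0 W M [::] #|M| maxM PM (erefl _) i0M.
- by case.
- by case.
move/partial_transversalP: (PM') => [MW binj ind].
have LM : {subset leaves M' cs <= M'} by move=> x; rewrite inE => /andP[].
exists (i0 |: b @: leaves M' cs), (leaves M' cs), [set x in cs]; split; split.
- by apply/subsetP=> x /LM; apply: (subsetP MW).
- apply/subsetP=> x; rewrite inE => xcs; case/splitPr: xcs ok => p q ok.
  by case: (ok _ _ _ (erefl _)).
- by rewrite cardsE; apply: (leq_trans (card_size _)); apply: size_centres ok hit.
- rewrite cardsU1 card_in_imset; last by move=> x y /LM xM /LM yM; apply: binj.
  suff -> : i0 \notin b @: leaves M' cs by [].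
  by apply: contra i0M' => /imsetP[x /LM xM ->]; apply: imset_f.
- by move=> l lL; rewrite !inE imset_f ?orbT.
- by move=> x y /LM xM /LM yM; apply: binj.
- by move=> x y /LM xM /LM yM; apply: ind.
- move=> l; rewrite inE => /andP[lM /hasP[c ccs lc]].
  apply/eqP/cards1P; exists c; apply/setP=> x; rewrite !inE.
  apply/andP/eqP => [[lx xcs]|->]; last by rewrite lc ccs.
  apply/eqP; apply: contraLR lx => xc.
  case/splitPr: ccs ok xcs => p q ok.
  rewrite mem_cat inE (negPf xc) /= -mem_cat.
  exact: (leaves_unique_centre ok (erefl _) lM lc).
- move=> v vW /(dom v vW)[x xin vx]; exists x => //.
  by rewrite inE inE.
Qed.
End Haxell.

(** * Weighted independent transversals *)

Lemma sumz_nat (J : finType) (P : pred J) (F : J -> nat) :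
  (\sum_(j | P j) (F j)%:Z = (\sum_(j | P j) F j)%N%:Z)%R.
Proof. by rewrite (big_morph Posz PoszD (erefl _)). Qed.

Lemma sum_mem (J : finType) (A : {set J}) : \sum_j (j \in A) = #|A|.
Proof. by rewrite -sum1_card [RHS]big_mkcond; apply: eq_bigr => j _; case: (j \in A). Qed.

Lemma sum_adj (V : finType) (e : rel V) (X : {set V}) v :
  \sum_(x in X) e v x = #|nbhd e v :&: X|.
Proof.
rewrite -sum1dep_card big_mkcond [RHS]big_mkcond; apply: eq_bigr => x _.
by rewrite !inE; case: (x \in X); case: (e v x).
Qed.

Lemma sum_nbhd_exchange (V : finType) (e : rel V) (A B : {set V}) :
  symmetric e ->
  \sum_(v in A) #|nbhd e v :&: B| = \sum_(x in B) #|nbhd e x :&: A|.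
Proof.
move=> es; under eq_bigr => v _ do rewrite -sum_adj.
under [RHS]eq_bigr => v _ do rewrite -sum_adj.
by rewrite exchange_big; apply: eq_bigr => x _; apply: eq_bigr => y _; rewrite es.
Qed.

Definition replace (V I : finType) (T : {ffun I -> V}) (i : I) (x : V) : {ffun I -> V} :=
  [ffun j => if j == i then x else T j].

Lemma replace_indep_transversal (V I : finType) (e : rel V) (b : V -> I)
    (T : {ffun I -> V}) i x :
  symmetric e -> irreflexive e -> indep_transversal e b T ->
  b x = i -> (forall j, j != i -> ~~ e x (T j)) ->
  indep_transversal e b (replace T i x).
Proof.
move=> es ei /andP[/forallP bT /forallP iT] bx xT.
apply/andP; split; apply/forallP=> j; first by rewrite ffunE; case: (eqVneq j i) => [->|_] //; apply/eqP.
apply/forallP=> j'; rewrite !ffunE.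
case: (eqVneq j i) => [_|ji]; case: (eqVneq j' i) => [_|ji'] //.
- by rewrite ei.
- exact: xT.
- by rewrite es xT.
- by move/forallP: (iT j); apply.
Qed.

Section Weighted.
Variables (V I : finType) (e : rel V) (b : V -> I).
Hypotheses (es : symmetric e) (ei : irreflexive e).
Variables (R : {set V}) (s D : nat).
Hypotheses (s0 : 0 < s) (Ds : D.*2 <= s).
Hypothesis (Rs : forall i, #|[set x in R | b x == i]| = s).
Hypothesis (RD : forall v, v \in R -> #|nbhd e v :&: R| <= D).

Lemma sum_blocks (g : I -> int) :
  (\sum_(v in R) g (b v) = s%:Z * \sum_i g i)%R.
Proof.
rewrite (partition_big b xpredT) //= mulr_sumr; apply: eq_bigr => i _.
rewrite (eq_bigr (fun=> g i)); last by move=> v /andP[_ /eqP->].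
rewrite sumr_const -(Rs i) -natz mulr_natl; congr (_ *+ _)%R.
by apply: eq_card => v; rewrite !inE.
Qed.

(* Removing [h] from the weights, where [h v] counts the neighbours of [v] in
   the stars found by [transversal_or_dominated], lowers the maximum in every
   block of [S], and a transversal that is good for the reduced weights can be
   chosen so that it meets or neighbours every leaf, which pays for [h]. *)
Lemma weighted_transversal_bounded n (g : I -> int) (w : V -> int) :
  (forall v, v \in R -> (w v <= g (b v))%R) ->
  (s%:Z * (\sum_i g i) - \sum_(v in R) w v < n%:Z)%R ->
  exists T, [/\ indep_transversal e b T, forall i, T i \in R
    & (\sum_(v in R) w v <= s%:Z * \sum_i w (T i))%R].
Proof.
elim: n g w => [|n IH] g w wg gap.
  have : (\sum_(v in R) w v <= \sum_(v in R) g (b v))%R by apply: ler_sum.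
  rewrite sum_blocks; lia.
have [[T TT TW]|] := transversal_or_dominated b es ei [set v in R | w v == g (b v)].
  have {TW} TW i : T i \in R /\ w (T i) = g i.
    have := TW i; rewrite inE => /andP[TR /eqP->]; split=> //.
    by rewrite (transversal_block i TT).
  exists T; split=> // [i|]; first by case: (TW i).
  rewrite (eq_bigr g) -?sum_blocks; last by move=> i _; case: (TW i).
  exact: ler_sum.
move=> [S [L [C [[LW CW CL LS] [bL binj indL LC dom]]]]].
have WR x : x \in [set v in R | w v == g (b v)] -> x \in R by rewrite inE => /andP[].
have LR x : x \in L -> x \in R by move=> /(subsetP LW)/WR.
have CR x : x \in C -> x \in R by move=> /(subsetP CW)/WR.
pose h v := #|nbhd e v :&: C| + #|nbhd e v :&: L|.
pose w' v := (w v - (h v)%:Z)%R.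
pose g' i := (g i - (i \in S)%:Z)%R.
(* Double counting: the at most [2 * #|L|] vertices of [C] and [L] have at most [D] neighbours in
   [R] each, and [2 * D <= s]. *)
have sumh : \sum_(v in R) h v <= s * #|L|.
  rewrite big_split /= (sum_nbhd_exchange R C es) (sum_nbhd_exchange R L es).
  have bnd (X : {set V}) : (forall x, x \in X -> x \in R) ->
      \sum_(x in X) #|nbhd e x :&: R| <= #|X| * D.
    by move=> XR; rewrite -sum_nat_const; apply: leq_sum => x /XR; apply: RD.
  have := bnd _ LR; have := bnd _ CR.
  have : #|C| * D <= #|L| * D by rewrite leq_mul2r CL orbT.
  have : #|L| * D.*2 <= #|L| * s by rewrite leq_mul2l Ds orbT.
  rewrite -addnn mulnDr [s * _]mulnC; lia.
have sumw' : (\sum_(v in R) w' v = \sum_(v in R) w v - (\sum_(v in R) h v)%N%:Z)%R.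
  by rewrite sumrB sumz_nat.
have sumg' : (\sum_i g' i = \sum_i g i - #|S|%:Z)%R.
  by rewrite sumrB sumz_nat sum_mem.
have w'g' v : v \in R -> (w' v <= g' (b v))%R.
  move=> vR; have := wg _ vR; rewrite /w' /g'.
  case: (boolP (b v \in S)) => bS; last by lia.
  case: (eqVneq (w v) (g (b v))) => [E _|]; last by lia.
  have [||x] := dom v _ _; rewrite ?inE ?vR ?E ?eqxx // => xCL vx.
  suff : 0 < h v by lia.
  rewrite addn_gt0 !card_gt0; apply/orP; case/orP: xCL => xin; [left|right];
    by apply/set0Pn; exists x; rewrite !inE vx xin.
pose good (T : {ffun I -> V}) := [&& indep_transversal e b T, [forall i, T i \in R]
    & (\sum_(v in R) w' v <= s%:Z * \sum_i w' (T i))%R].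
have {}IH : exists T, good T.
  have [|T [T1 T2 T3]] := IH g' w' w'g'; last first.
    by exists T; rewrite /good T1 T3 andbT; apply/forallP.
  (* The block bounds lose [s * #|S|] in total and the weights at most [s * #|L|], so the gap
     shrinks by at least [s]. *)
  rewrite sumg' sumw'.
  have : s * #|L| + s <= s * #|S| by rewrite addnC -mulnS leq_mul2l LS orbT.
  move: gap sumh; rewrite mulrBr.
  have -> : (s%:Z * #|S|%:Z = (s * #|S|)%N%:Z)%R by [].
  lia.
have [T0 T0P] := IH.
(* A transversal good for [w'] with most vertices in [L] contains a neighbour of every leaf it
   omits: otherwise that leaf, where [w'] attains [g'], could be swapped in. *)
case: (arg_maxnP (fun T : {ffun I -> V} => #|[set i | T i \in L]|) T0P) => T.
move=> /and3P[TT /forallP TR Tw] Tmax.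
have bT i := transversal_block i TT.
have touch l : l \in L -> T (b l) != l -> exists i, e (T i) l.
  move=> lL Tl; have [/existsP //|] := boolP [exists i, e (T i) l].
  rewrite negb_exists => /forallP nl; exfalso.
  pose T1 := replace T (b l) l.
  have /Tmax : good T1.
    apply/and3P; split.
    - by apply: replace_indep_transversal => // j _; rewrite es.
    - by apply/forallP=> i; rewrite ffunE; case: eqP => // _; apply: LR.
    - apply: le_trans Tw _; rewrite ler_pM2l ?ltz_nat //; apply: ler_sum => i _.
      rewrite ffunE; case: eqP => [->|_] //.
      have := w'g' _ (TR (b l)); rewrite bT /g' bL //= /w'.
      have := subsetP LW _ lL; rewrite inE => /andP[_ /eqP->].
      suff -> : h l = 1 by lia.
      rewrite /h LC //; suff -> : nbhd e l :&: L = set0 by rewrite cards0.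
      apply/setP=> x; rewrite !inE; apply/andP=> -[lx xL].
      by move: lx; apply/negP/indL.
  apply/negP; rewrite -ltnNge; apply/proper_card/properP; split.
    apply/subsetP=> i; rewrite !inE ffunE => Ti; case: eqP => // _.
  exists (b l); rewrite !inE ?ffunE ?eqxx //.
  apply/negP=> TL; move/eqP: Tl; apply; apply: binj => //.
(* A leaf in [T] is paid for by its neighbour in [C], any other leaf by its neighbour in [T]. *)
have hT : #|L| <= \sum_i h (T i).
  pose A := [set l in L | T (b l) == l].
  rewrite big_split /= -(cardsID A L); apply: leq_add.
    have -> : L :&: A = A by apply/setIidPr/subsetP=> x; rewrite inE => /andP[].
    rewrite -(@card_in_imset _ _ b A); last first.
      by move=> x y; rewrite !inE => /andP[xL _] /andP[yL _]; apply: binj.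
    rewrite -sum1_card big_mkcond; apply: leq_sum => i _.
    case: ifP => // /imsetP[l]; rewrite inE => /andP[lL /eqP Tl] ->.
    by rewrite Tl LC.
  have -> : \sum_i #|nbhd e (T i) :&: L| = \sum_(l in L) \sum_i e (T i) l.
    by rewrite exchange_big; apply: eq_bigr => i _; rewrite sum_adj.
  rewrite -sum1_card big_mkcond [X in _ <= X]big_mkcond; apply: leq_sum => l _.
  rewrite !inE; case: (boolP (l \in L)) => lL //=; rewrite andbT.
  case: ifP => // Tl; have [i Til] := touch _ lL Tl.
  by rewrite (bigD1 i) //= Til.
exists T; split=> //.
have E : (\sum_i w' (T i) = \sum_i w (T i) - (\sum_i h (T i))%N%:Z)%R.
  by rewrite sumrB sumz_nat.
move: Tw; rewrite sumw' E mulrBr.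
have : s * #|L| <= s * \sum_i h (T i) by rewrite leq_mul2l hT orbT.
have -> : (s%:Z * (\sum_i h (T i))%N%:Z = (s * \sum_i h (T i))%N%:Z)%R by [].
move: sumh; lia.
Qed.

Theorem weighted_transversal (w : V -> int) :
  exists T, [/\ indep_transversal e b T, forall i, T i \in R
    & (\sum_(v in R) w v <= s%:Z * \sum_i w (T i))%R].
Proof.
pose g (i : I) : int := (\sum_v `|w v|)%R.
have wg v : v \in R -> (w v <= g (b v))%R.
  move=> _; rewrite /g (bigD1 v) //=; apply: le_trans (ler_norm _) _.
  by rewrite lerDl sumr_ge0.
pose x : int := (s%:Z * (\sum_i g i) - \sum_(v in R) w v)%R.
apply: (@weighted_transversal_bounded (absz x).+1 g w wg).
by rewrite -/x; lia.
Qed.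
End Weighted.

(** * Almost perfect tilings *)

(** The mixed terms are absorbed by the square [2 * a^2 * (X + a)^2], and [8 * s * X^2 * K^2] is
    split by the square of [X^2 - s * K^2]. The resulting [4 * X^4] is cancelled later by the choice
    of the transversal. *)
Lemma fourth_power_drift (X a K s : int) : (`|a| <= K -> 0 <= s ->
  s * (X - a) ^+ 4 <= s * X ^+ 4 - 4 * (s * (X ^+ 3 * a)) + 4 * X ^+ 4
                      + (4 * s ^+ 2 + 3 * s) * K ^+ 4)%R.
Proof.
move=> aK s0; have a2 : (a ^+ 2 <= K ^+ 2)%R.
  by rewrite -(real_normK (num_real a)) lerXn2r // nnegrE; lia.
have X2 : (0 <= X ^+ 2)%R by apply: sqr_ge0.
have a20 : (0 <= a ^+ 2)%R by apply: sqr_ge0.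
have a4 : (a ^+ 4 <= K ^+ 4)%R.
  by rewrite -[4]/(2 * 2)%N !exprM lerXn2r // nnegrE //; apply: le_trans a2.
have h1 : (0 <= 2 * a ^+ 2 * (X + a) ^+ 2)%R.
  by apply: mulr_ge0; [apply: mulr_ge0 | apply: sqr_ge0].
have h2 : (X ^+ 2 * a ^+ 2 <= X ^+ 2 * K ^+ 2)%R by apply: ler_wpM2l.
have h3 : (0 <= 4 * (X ^+ 2 - s * K ^+ 2) ^+ 2)%R by apply: mulr_ge0 => //; apply: sqr_ge0.
have h4 : ((X - a) ^+ 4 <= X ^+ 4 - 4 * (X ^+ 3 * a) + 8 * (X ^+ 2 * K ^+ 2) + 3 * K ^+ 4)%R.
  have -> : ((X - a) ^+ 4 = X ^+ 4 - 4 * (X ^+ 3 * a) + 8 * (X ^+ 2 * a ^+ 2)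
     + 3 * a ^+ 4 - 2 * a ^+ 2 * (X + a) ^+ 2)%R by ring.
  lra.
have := ler_wpM2l s0 h4.
have -> : (s * (X ^+ 4 - 4 * (X ^+ 3 * a) + 8 * (X ^+ 2 * K ^+ 2) + 3 * K ^+ 4) =
  s * X ^+ 4 - 4 * (s * (X ^+ 3 * a)) + 4 * X ^+ 4 + (4 * s ^+ 2 + 3 * s) * K ^+ 4
  - 4 * (X ^+ 2 - s * K ^+ 2) ^+ 2)%R by ring.
lra.
Qed.

Definition balanced (V I : finType) (b : V -> I) (R : {set V}) (s : nat) : Prop :=
  forall i, #|[set x in R | b x == i]| = s.

Section Tiling.
Variables (V I : finType) (e : rel V) (b : V -> I).
Hypotheses (es : symmetric e) (ei : irreflexive e).

Definition verts (T : {ffun I -> V}) : seq V := codom T.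
Definition remaining (R : {set V}) (T : {ffun I -> V}) : {set V} := [set x in R | x \notin verts T].

Section Remove.
Variables (R : {set V}) (T : {ffun I -> V}).
Hypotheses (bT : forall i, b (T i) = i) (TR : forall i, T i \in R).

Lemma transversal_inj : injective T.
Proof. by move=> i j; rewrite -{2}(bT i) -{2}(bT j) => ->. Qed.

Lemma balanced_remaining s : balanced b R s.+1 -> balanced b (remaining R T) s.
Proof.
move=> Rs i; have := Rs i; rewrite (cardsD1 (T i)) !inE TR bT eqxx add1n => -[<-].
apply: eq_card => x; rewrite !inE.
case: (boolP (b x == i)) => [/eqP bx|_]; last by rewrite !andbF.
rewrite !andbT andbC; congr (~~ _ && _).
apply/codomP/eqP => [[j xj]|->]; last by exists i.
by rewrite xj; congr (T _); rewrite -bx xj bT.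
Qed.

Lemma perm_remaining : perm_eq (verts T ++ enum (remaining R T)) (enum R).
Proof.
apply: uniq_perm.
- rewrite cat_uniq enum_uniq (map_inj_uniq transversal_inj) enum_uniq /= andbT.
  by apply/hasPn=> x; rewrite mem_enum inE => /andP[].
- exact: enum_uniq.
- move=> x; rewrite mem_cat !mem_enum inE.
  case: (boolP (x \in verts T)) => [/codomP[i ->]|_] /=; last by rewrite andbT.
  by rewrite TR.
Qed.

Lemma sum_remaining (F : V -> nat) :
  \sum_(x in R) F x = \sum_(x in remaining R T) F x + \sum_i F (T i).
Proof.
have E (X : {set V}) : \sum_(x in X) F x = \sum_(x <- enum X) F x by rewrite big_enum.
rewrite !E -(perm_big _ perm_remaining) /= big_cat /= addnC.
by congr (_ + _); rewrite big_image.
Qed.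

Lemma degree_remaining v :
  #|nbhd e v :&: R| = #|nbhd e v :&: remaining R T| + \sum_i e v (T i).
Proof. by rewrite -!sum_adj sum_remaining.
Qed.
End Remove.

(** * Greedy removal controlled by a fourth moment *)

Section Greedy.
Variables (R0 : {set V}) (s0 h D q : nat).
Hypotheses (bal0 : balanced b R0 s0) (deg0 : forall v, #|nbhd e v :&: R0| <= D).
Hypotheses (slack : D.*2 + q <= s0) (h0 : 0 < h).
(** [K] bounds the change of a drift in one step and [B] the growth of the potential: the error term
    of [fourth_power_drift] divided by [s], with [4 * s + 3 <= 7 * s0], summed over [V]. *)
Let K := #|I| * s0.
Let B := #|V| * (7 * s0 * K ^ 4).
Hypothesis large : 16 * (s0 * B) < (h * q) ^ 4.

(* Along a uniformly random greedy process the degree of [v] in the remaining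
   set stays proportional to the size [s] of the blocks; [drift] is the scaled
   deviation, and the sum of its fourth powers is the quantity that the choice
   of each transversal controls. *)
Definition drift (R : {set V}) (s : nat) (v : V) : int :=
  (s0%:Z * #|nbhd e v :&: R|%:Z - s%:Z * #|nbhd e v :&: R0|%:Z)%R.

Definition potential (R : {set V}) (s : nat) : int := (\sum_v drift R s v ^+ 4)%R.

(** A degree above [s / 2] would give a drift of at least [s * (s0 - 2 * D) / 2 >= h * q / 2], whose
    fourth power alone exceeds [s0 * B]; the [16] in [large] is [2 ^ 4]. *)
Lemma degree_of_potential R s v :
  h <= s -> s <= s0 -> (potential R s <= ((s0 - s) * B)%N%:Z)%R ->
  #|nbhd e v :&: R|.*2 <= s.
Proof.
move=> hs ss0 pot; rewrite leqNgt; apply/negP=> lt.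
have X4 : (drift R s v ^+ 4 <= (s0 * B)%N%:Z)%R.
  apply: (@le_trans _ _ (potential R s)).
    rewrite /potential (bigD1 v) //= lerDl; apply: sumr_ge0 => u _.
    by rewrite -[4]/(2 * 2)%N exprM sqr_ge0.
  by apply: le_trans pot _; rewrite lez_nat leq_mul2r leq_subr orbT.
have q2 : ((h * q)%N%:Z <= 2 * drift R s v)%R.
  rewrite /drift; have d0 := deg0 v.
  have : (h * q <= s * (s0 - D.*2))%N by apply: leq_mul => //; lia.
  have : (s * #|nbhd e v :&: R0| <= s * D)%N by rewrite leq_mul2l d0 orbT.
  have : (s0 * s <= s0 * #|nbhd e v :&: R|.*2)%N by rewrite leq_mul2l (ltnW lt) orbT.
  rewrite mulnBr -!muln2 !mulnA.
  have : (s * D * 2 <= s * s0)%N by rewrite -mulnA leq_mul2l; apply/orP; right; lia.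
  rewrite [(s0 * s)%N]mulnC; lia.
have : (((h * q) ^ 4)%N%:Z <= (2 * drift R s v) ^+ 4)%R.
  by rewrite -natz natrX lerXn2r ?nnegrE //; lia.
rewrite exprMn; move: large X4; lia.
Qed.

(** The weights are, up to scaling, the derivative of the potential, so the chosen transversal does
    at least as well as a random one: [S4 <= s.+1 * S3]. The terms in [S3] and [S4] then only help,
    and at most [B] is added. *)
Lemma greedy_step R s :
  balanced b R s.+1 -> h <= s.+1 -> s < s0 ->
  (potential R s.+1 <= ((s0 - s.+1) * B)%N%:Z)%R ->
  exists T, [/\ indep_transversal e b T, forall i, T i \in R
    & (potential (remaining R T) s <= ((s0 - s) * B)%N%:Z)%R].
Proof.
move=> balR hs ss0 pot.
pose X := drift R s.+1.
pose d v := #|nbhd e v :&: R|; pose d0 v := #|nbhd e v :&: R0|.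
pose w u := (\sum_v X v ^+ 3 * (e v u)%:Z)%R.
(* The degree bound is half the current block size, supplied by the potential, since [D] itself may
   be too large by now. *)
have [||v _|T [TT TR Tw]] :=
    @weighted_transversal V I e b es ei R s.+1 (s.+1)./2 _ _ balR _ w.
- by [].
- by rewrite -{2}(odd_double_half s.+1) leq_addl.
- by rewrite geq_half_double; apply: degree_of_potential pot.
have bT i := transversal_block i TT.
exists T; split=> //.
pose j v := \sum_i e v (T i).
pose a v := (s0%:Z * (j v)%:Z - (d0 v)%:Z)%R.
have XE v : (drift (remaining R T) s v = X v - a v)%R.
  rewrite /X /drift (degree_remaining bT TR) /a /j /d0; lia.
have aK v : (`|a v| <= K%:Z)%R.
  have jI : j v <= #|I| by rewrite -sum1_card; apply: leq_sum => i _; case: (e v (T i)).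
  have I0 : 0 < #|I| by apply/card_gt0P; exists (b v).
  have := deg0 v; rewrite -/(d0 v) /a /K => d0D.
  have : (s0 * j v <= s0 * #|I|)%N by rewrite leq_mul2l jI orbT.
  have : (s0 * 1 <= s0 * #|I|)%N by rewrite leq_mul2l I0 orbT.
  rewrite [(s0 * #|I|)%N]mulnC; lia.
have wR : (\sum_(u in R) w u = \sum_v X v ^+ 3 * (d v)%:Z)%R.
  rewrite exchange_big /=; apply: eq_bigr => v _; rewrite -mulr_sumr; congr (_ * _)%R.
  by rewrite sumz_nat sum_adj.
have wT : (\sum_i w (T i) = \sum_v X v ^+ 3 * (j v)%:Z)%R.
  by rewrite exchange_big /=; apply: eq_bigr => v _; rewrite -mulr_sumr sumz_nat.
pose S4 := (\sum_v X v ^+ 4)%R; pose S3 := (\sum_v X v ^+ 3 * a v)%R.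
have S34 : (S4 <= s.+1%:Z * S3)%R.
  have -> : (S4 = s0%:Z * (\sum_v X v ^+ 3 * (d v)%:Z) - s.+1%:Z * (\sum_v X v ^+ 3 * (d0 v)%:Z))%R.
    rewrite !mulr_sumr -sumrB; apply: eq_bigr => v _.
    by rewrite exprSr {2}/X /drift -/(d v) -/(d0 v); ring.
  have -> : (S3 = s0%:Z * (\sum_v X v ^+ 3 * (j v)%:Z) - \sum_v X v ^+ 3 * (d0 v)%:Z)%R.
    by rewrite mulr_sumr -sumrB; apply: eq_bigr => v _; rewrite /a; ring.
  move: Tw; rewrite wR wT => Tw.
  rewrite mulrBr lerD2r mulrCA ler_wpM2l //.
have drop : (s.+1%:Z * potential (remaining R T) s <= s.+1%:Z * S4 - 4 * (s.+1%:Z * S3) + 4 * S4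
    + #|V|%:Z * ((4 * s.+1%:Z ^+ 2 + 3 * s.+1%:Z) * K%:Z ^+ 4))%R.
  have -> : (#|V|%:Z * ((4 * s.+1%:Z ^+ 2 + 3 * s.+1%:Z) * K%:Z ^+ 4) =
     \sum_(v : V) (4 * s.+1%:Z ^+ 2 + 3 * s.+1%:Z) * K%:Z ^+ 4)%R.
    by rewrite sumr_const -[RHS]mulr_natl -[#|V|%:Z%R]natz.
  rewrite /S3 /S4 /potential !mulr_sumr -sumrB -!big_split /=; apply: ler_sum => v _.
  by rewrite XE; apply: fourth_power_drift.
have : (s.+1%:Z * potential (remaining R T) s <= s.+1%:Z * ((s0 - s) * B)%N%:Z)%R.
  apply: (le_trans drop).
  have : (s.+1%:Z * S4 <= s.+1%:Z * ((s0 - s.+1) * B)%N%:Z)%R by rewrite ler_pM2l.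
  have : (#|V|%:Z * ((4 * s.+1%:Z ^+ 2 + 3 * s.+1%:Z) * K%:Z ^+ 4) <= s.+1%:Z * B%:Z)%R.
    have -> : (#|V|%:Z * ((4 * s.+1%:Z ^+ 2 + 3 * s.+1%:Z) * K%:Z ^+ 4) =
       (s.+1 * (#|V| * ((4 * s.+1 + 3) * K ^ 4)))%N%:Z)%R.
      have -> : (K%:Z ^+ 4 = (K ^ 4)%N%:Z)%R by rewrite -natz -natrX natz.
      by move: (K ^ 4) => K4; rewrite !PoszM PoszD PoszM; ring.
    rewrite -PoszM lez_nat leq_mul2l /B !leq_mul2l leq_mul2r; apply/orP; right.
    by apply/orP; right; apply/orP; right; lia.
  have -> : (((s0 - s) * B)%N%:Z = ((s0 - s.+1) * B)%N%:Z + B%:Z)%R.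
    by rewrite -PoszD -mulSnr; congr (Posz (_ * _)); lia.
  rewrite mulrDr; move: S34; lra.
by rewrite ler_pM2l.
Qed.

Lemma almost_tiling s : h <= s -> s <= s0 ->
  exists ts R, [/\ all (indep_transversal e b) ts, balanced b R s
    & perm_eq (flatten (map verts ts) ++ enum R) (enum R0)].
Proof.
move=> hs ss0.
suff [ts [R [? ? ? _]]] : exists ts R, [/\ all (indep_transversal e b) ts, balanced b R s,
    perm_eq (flatten (map verts ts) ++ enum R) (enum R0)
    & (potential R s <= ((s0 - s) * B)%N%:Z)%R] by exists ts, R.
have [n] := ubnP (s0 - s); elim: n s hs ss0 => // n IH s hs ss0 lt.
have [->|ss0'] := eqVneq s s0.
  exists [::], R0; split=> //.
  by rewrite /potential big1 // => v _; rewrite /drift subrr expr0n.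
have s_lt : s < s0 by rewrite ltn_neqAle ss0'.
have [||ts [R [tsT balR pm pot]]] := IH s.+1 _ s_lt.
- exact: leqW.
- by move: lt s_lt; lia.
have [T [TT TR pot']] := greedy_step balR (leqW hs) s_lt pot.
have bT i := transversal_block i TT.
exists (rcons ts T), (remaining R T); split=> //.
- by rewrite all_rcons TT.
- exact: balanced_remaining.
- apply: perm_trans pm; rewrite map_rcons flatten_rcons -catA perm_cat2l.
  exact: perm_remaining.
Qed.
End Greedy.
End Tiling.

(** * Absorbers *)

Section Absorption.
Variables (V I : finType) (e : rel V) (b : V -> I).
Hypotheses (es : symmetric e) (ei : irreflexive e).
Local Notation ffVI := {ffun I -> V}.
Local Notation verts := (@verts V I).

Definition tileable (s : seq V) : Prop :=
  exists2 ts : seq ffVI, all (indep_transversal e b) ts & perm_eq (flatten (map verts ts)) s.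

Lemma tileable_cat s1 s2 : tileable s1 -> tileable s2 -> tileable (s1 ++ s2).
Proof.
move=> [t1 a1 p1] [t2 a2 p2]; exists (t1 ++ t2); first by rewrite all_cat a1.
by rewrite map_cat flatten_cat perm_cat.
Qed.

Lemma tileable_perm s1 s2 : perm_eq s1 s2 -> tileable s1 -> tileable s2.
Proof. by move=> p [ts a1 p1]; exists ts => //; apply: perm_trans p. Qed.

(* [A = (T, F)] is made of the transversal [T] and, for each block [i], of
   [F i] without its vertex in block [i]; completing each [F i] with [T i], or
   using [T] whole and completing each [F i] with [Z i], gives the two tilings. *)
Definition absorber : Type := (ffVI * {ffun I -> ffVI})%type.

Definition others (F : ffVI) (i : I) : seq V := [seq F j | j <- enum I & j != i].

Definition absorber_verts (A : absorber) : seq V :=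
  verts A.1 ++ flatten [seq others (A.2 i) i | i <- enum I].

Definition avoids (F : ffVI) (x : V) : bool := [forall j, ~~ e x (F j)].

Definition absorbs (A : absorber) (Z : ffVI) : bool := [forall i, avoids (A.2 i) (Z i)].

Definition is_absorber (A : absorber) : bool :=
  [&& indep_transversal e b A.1, [forall i, indep_transversal e b (A.2 i)] & absorbs A A.1].

Lemma perm_replace (F : ffVI) i x : perm_eq (verts (replace F i x)) (x :: others F i).
Proof.
have pe : perm_eq (enum I) (i :: [seq j <- enum I | j != i]).
  by rewrite -rem_filter ?enum_uniq // perm_to_rem // mem_enum.
have E : [seq replace F i x j | j <- enum I & j != i] = others F i.
  by apply/eq_in_map => j; rewrite mem_filter ffunE => /andP[/negPf->].
by rewrite /verts codomE (perm_trans (perm_map _ pe)) //= ffunE eqxx perm_cons E.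
Qed.

Lemma perm_replace_all (F : {ffun I -> ffVI}) (X : ffVI) (l : seq I) :
  perm_eq (flatten [seq verts (replace (F i) i (X i)) | i <- l])
          ([seq X i | i <- l] ++ flatten [seq others (F i) i | i <- l]).
Proof.
elim: l => //= i l IH.
apply: perm_trans (perm_cat (perm_replace _ _ _) IH) _.
by rewrite /= perm_cons perm_catCA.
Qed.

Lemma absorber_tileable_with A X :
  is_absorber A -> absorbs A X -> (forall i, b (X i) = i) ->
  tileable (verts X ++ flatten [seq others (A.2 i) i | i <- enum I]).
Proof.
move=> /and3P[_ /forallP FT _] /forallP AX bX.
exists [seq replace (A.2 i) i (X i) | i <- enum I].
  apply/allP=> _ /mapP[i _ ->]; apply: replace_indep_transversal => // j _.
  by have /forallP := AX i; apply.
by rewrite -map_comp; apply: perm_replace_all.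
Qed.

Lemma absorber_tileable A : is_absorber A -> tileable (absorber_verts A).
Proof.
move=> AA; have /and3P[/andP[/forallP bT _] _ AT] := AA.
by apply: absorber_tileable_with => // i; apply/eqP.
Qed.

Lemma absorber_tileable_more A Z :
  is_absorber A -> absorbs A Z -> (forall i, b (Z i) = i) ->
  tileable (absorber_verts A ++ verts Z).
Proof.
move=> AA AZ bZ; have /and3P[TT _ _] := AA.
apply: (@tileable_perm (verts A.1 ++ (verts Z ++ flatten [seq others (A.2 i) i | i <- enum I]))).
  by rewrite -catA perm_cat2l perm_catC.
apply: tileable_cat; last exact: absorber_tileable_with.
by exists [:: A.1]; rewrite /= ?TT ?cats0.
Qed.

(** Each [Z] in turn uses up one absorber, which lowers every count by at most one; absorbers left
    over are tiled on their own. *)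
Lemma absorb_all (As : seq absorber) (Zs : seq ffVI) :
  all is_absorber As -> (forall Z, Z \in Zs -> forall i, b (Z i) = i) ->
  (forall Z, size Zs <= count (absorbs^~ Z) As) ->
  tileable (flatten (map absorber_verts As) ++ flatten (map verts Zs)).
Proof.
elim: Zs As => [|Z Zs IH] As allA bZ cnt.
  rewrite cats0; elim: As allA {cnt} => [|A As IHA] /=; first by exists [::].
  by move=> /andP[AA /IHA]; apply: tileable_cat; apply: absorber_tileable.
have /hasP[A AAs AZ] : has (absorbs^~ Z) As by rewrite has_count; apply: leq_trans (cnt Z).
have pA := perm_to_rem AAs.
have {}allA : all is_absorber (A :: rem A As) by rewrite -(perm_all _ pA).
have /andP[AA allA'] := allA.
have t1 : tileable (absorber_verts A ++ verts Z).
  by apply: absorber_tileable_more => //; apply: bZ; rewrite mem_head.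
have t2 : tileable (flatten (map absorber_verts (rem A As)) ++ flatten (map verts Zs)).
  apply: IH => // [Z' Zin|Z']; first by apply: bZ; rewrite inE Zin orbT.
  have := cnt Z'; rewrite (permP pA) /=; case: (absorbs A Z') => //= le; exact: ltnW.
apply: tileable_perm (tileable_cat t1 t2).
rewrite perm_sym.
apply: perm_trans (perm_cat (perm_flatten (perm_map _ pA)) (perm_refl _)) _.
by rewrite /= -!catA !perm_cat2l perm_catCA.
Qed.

Lemma split_transversals (R : {set V}) h : balanced b R h ->
  exists Zs : seq ffVI, [/\ size Zs = h, forall Z, Z \in Zs -> forall i, b (Z i) = i
    & (0 < #|I|) -> perm_eq (flatten (map verts Zs)) (enum R)].
Proof.
elim: h R => [|h IH] R bal.
  exists [::]; split=> // I0; suff -> : R = set0 by rewrite enum_set0.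
  apply/setP=> x; rewrite inE; apply/negP=> xR.
  have /eqP := bal (b x); rewrite cards_eq0 => /eqP/setP/(_ x).
  by rewrite !inE xR eqxx.
have ex i : exists x, (x \in R) && (b x == i).
  have : 0 < #|[set x in R | b x == i]| by rewrite bal.
  by case/card_gt0P=> x; rewrite inE; exists x.
pose Z := [ffun i => xchoose (ex i)].
have ZR i : Z i \in R by rewrite ffunE; case/andP: (xchooseP (ex i)).
have bZ i : b (Z i) = i by rewrite ffunE; case/andP: (xchooseP (ex i)) => _ /eqP.
have [Zs [sz bZs pm]] := IH _ (balanced_remaining bZ ZR bal).
exists (Z :: Zs); split=> [|Z'|I0]; first by rewrite /= sz.
  by rewrite inE => /orP[/eqP->|/bZs].
apply: perm_trans (perm_remaining bZ ZR).
by rewrite /= perm_cat2l; apply: pm.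
Qed.

(** * Choosing absorbers with the weighted theorem *)

Section Selection.
Variables (D a smin : nat).
Hypotheses (smin0 : 0 < smin) (Dsmin : D.*2 <= smin).
Hypothesis slack : forall s, smin <= s -> s <= a * (s - D.*2).
Hypothesis deg : forall v, #|nbhd e v| <= D.

Lemma deg_in (R : {set V}) v : #|nbhd e v :&: R| <= D.
Proof. by apply: leq_trans (deg v); apply/subset_leq_card/subsetIl. Qed.

(** Applied to [- w], the weighted theorem yields a transversal of at most average cost. *)
Lemma choose_transversal (R : {set V}) s (w : V -> nat) :
  balanced b R s -> smin <= s ->
  exists T, [/\ indep_transversal e b T, forall i, T i \in R
    & s * \sum_i w (T i) <= \sum_(v in R) w v].
Proof.
move=> bal ms; have [||v _|T [TT TR Tw]] :=
    @weighted_transversal V I e b es ei R s D _ _ bal _ (fun v => - (w v)%:Z)%R.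
- exact: leq_trans ms.
- exact: leq_trans ms.
- exact: deg_in.
exists T; split=> //.
move: Tw; rewrite !sumrN !sumz_nat mulrN lerN2 -PoszM lez_nat //.
Qed.

(** With cost [w], the [phi]-average number of edges from [Z i] and [T i] to [F] is at most
    [2 * D / s], so the [Z] with no such edge carry a proportion at least [1 - 2 * D / s >= 1 / a]
    of [phi]. Any one of them also shows that [F] avoids [T i]. *)
Lemma choose_linking (T : ffVI) (phi : ffVI -> nat) (i : I) (R : {set V}) s :
  balanced b R s -> smin <= s -> 0 < \sum_Z phi Z ->
  exists F, [/\ indep_transversal e b F, forall j, F j \in R, avoids F (T i)
    & \sum_Z phi Z <= a * \sum_(Z : ffVI | avoids F (Z i)) phi Z].
Proof.
move=> bal ms phi0.
pose w v := \sum_(Z : ffVI) phi Z * (e (Z i) v + e (T i) v).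
have [F [FT FR Fw]] := choose_transversal w bal ms.
pose c (Z : ffVI) := \sum_j (e (Z i) (F j) + e (T i) (F j)).
have cE : \sum_j w (F j) = \sum_Z phi Z * c Z.
  by rewrite exchange_big; apply: eq_bigr => Z _; rewrite big_distrr.
have wR : \sum_(v in R) w v <= (\sum_Z phi Z) * D.*2.
  rewrite exchange_big big_distrl; apply: leq_sum => Z _; rewrite -big_distrr leq_mul2l.
  apply/orP; right; rewrite big_split -addnn.
  by rewrite !sum_adj; apply: leq_add; apply: deg_in.
pose U := \sum_(Z | c Z == 0) phi Z.
have U1 : \sum_Z phi Z <= U + \sum_Z phi Z * c Z.
  rewrite (bigID (fun Z => c Z == 0)) /= leq_add2l [X in _ <= X](bigID (fun Z => c Z == 0)) /=.
  apply: leq_trans (leq_addl _ _); apply: leq_sum => Z cZ.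
  by rewrite leq_pmulr // lt0n.
have sU : s * \sum_Z phi Z <= s * U + (\sum_Z phi Z) * D.*2.
  apply: (@leq_trans (s * (U + \sum_Z phi Z * c Z))); first by rewrite leq_mul2l U1 orbT.
  by rewrite mulnDr leq_add2l -cE; apply: leq_trans Fw _.
have aU : \sum_Z phi Z <= a * U.
  have s0 : 0 < s by apply: leq_trans ms.
  rewrite -(leq_pmul2l s0).
  move: sU; set P := \sum_Z phi Z => sU.
  have h1 : P * (s - D.*2) <= s * U by rewrite mulnBr [P * s]mulnC leq_subLR addnC.
  have h2 : s * P <= a * (s - D.*2) * P by rewrite leq_mul2r slack // orbT.
  have h3 : a * (P * (s - D.*2)) <= a * (s * U) by rewrite leq_mul2l h1 orbT.
  apply: leq_trans h2 _; rewrite [s * _]mulnC -mulnA [_ * P]mulnC.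
  by apply: leq_trans h3 _; rewrite [s * U]mulnC mulnA.
have c0 Z : c Z == 0 -> avoids F (Z i) && avoids F (T i).
  move=> /eqP cZ; apply/andP; split; apply/forallP=> j; apply/negP=> ej.
    by move: cZ; rewrite /c (bigD1 j) //= ej.
  by move: cZ; rewrite /c (bigD1 j) //= ej addn1 addSn.
exists F; split=> //.
- have : 0 < U by move: aU phi0; case: (U) => //; rewrite muln0; lia.
  rewrite lt0n sum_nat_eq0 negb_forall => /existsP[Z]; rewrite negb_imply => /andP[cZ _].
  by case/andP: (c0 _ cZ).
- apply: leq_trans aU _; rewrite leq_mul2l; apply/orP; right.
  rewrite /U big_mkcond [X in _ <= X]big_mkcond; apply: leq_sum => Z _.
  by case: ifP => // /c0/andP[-> _].
Qed.

(** The blocks are handled in turn, [phi] being restricted each time to the [Z] that pass so far, so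
    each block costs a factor [a]. *)
Lemma choose_linkings (T : ffVI) (l : seq I) (phi : ffVI -> nat) (R : {set V}) s :
  uniq l -> balanced b R (s + size l) -> smin <= s -> 0 < \sum_Z phi Z ->
  exists (F : {ffun I -> ffVI}) (R' : {set V}),
    [/\ forall i, i \in l -> indep_transversal e b (F i) && avoids (F i) (T i),
        balanced b R' s,
        perm_eq (flatten [seq verts (F i) | i <- l] ++ enum R') (enum R)
      & \sum_Z phi Z <= a ^ size l * \sum_(Z : ffVI | all (fun i => avoids (F i) (Z i)) l) phi Z].
Proof.
elim: l phi R => [|i l IH] phi R /= => [_|/andP[il ui]] bal ms phi0.
  exists [ffun=> T], R; split=> //; first by move: bal; rewrite addn0.
  by rewrite expn0 mul1n.
rewrite addnS in bal.
have [F1 [F1T F1R F1a F1phi]] := choose_linking T i bal (leq_trans ms (leqW (leq_addr _ _))) phi0.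
pose phi' (Z : ffVI) := if avoids F1 (Z i) then phi Z else 0.
have E P : \sum_(Z | P Z) phi' Z = \sum_(Z : ffVI | avoids F1 (Z i) && P Z) phi Z.
  rewrite big_mkcond [RHS]big_mkcond; apply: eq_bigr => Z _; rewrite /phi'.
  by case: (P Z); case: (avoids F1 (Z i)).
have E1 : \sum_Z phi' Z = \sum_(Z : ffVI | avoids F1 (Z i)) phi Z.
  by rewrite E; apply: eq_bigl => Z; rewrite andbT.
have phi'0 : 0 < \sum_Z phi' Z.
  rewrite E1 lt0n; apply: contraTneq phi0 => E0.
  by rewrite -leqNgt; move: F1phi; rewrite E0 muln0.
have bF i' := transversal_block i' F1T.
have [F [R' [Fok bal' pm Fphi]]] := IH phi' _ ui (balanced_remaining bF F1R bal) ms phi'0.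
pose F' := [ffun j => if j == i then F1 else F j].
have F'F j : j \in l -> F' j = F j.
  by move=> jl; rewrite ffunE; case: eqP => // ji; rewrite -ji jl in il.
exists F', R'; split=> //.
- move=> j; rewrite inE => /orP[/eqP->|jl]; first by rewrite ffunE eqxx F1T.
  by rewrite F'F //; apply: Fok.
- have -> : [seq verts (F' j) | j <- l] = [seq verts (F j) | j <- l].
    by apply/eq_in_map=> j jl; rewrite F'F.
  rewrite ffunE eqxx -catA; apply: perm_trans (perm_remaining bF F1R).
  by rewrite perm_cat2l.
- apply: leq_trans F1phi _; rewrite expnS -mulnA leq_mul2l -E1; apply/orP; right.
  apply: leq_trans Fphi _; rewrite leq_mul2l E; apply/orP; right.
  rewrite big_mkcond [X in _ <= X]big_mkcond; apply: leq_sum => Z _ /=.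
  rewrite ffunE eqxx.
  have -> : all (fun j => avoids (F' j) (Z j)) l = all (fun j => avoids (F j) (Z j)) l.
    by apply: eq_in_all => j jl; rewrite F'F.
  by [].
Qed.

Lemma choose_absorber (phi : ffVI -> nat) (R : {set V}) s :
  balanced b R (s + #|I|.+1) -> smin <= s -> 0 < \sum_Z phi Z ->
  exists (A : absorber) (W : seq V) (R' : {set V}),
    [/\ is_absorber A, balanced b R' s,
        perm_eq (absorber_verts A ++ (W ++ enum R')) (enum R)
      & \sum_Z phi Z <= a ^ #|I| * \sum_(Z | absorbs A Z) phi Z].
Proof.
rewrite addnS => bal ms phi0.
have [T [TT TR _]] := choose_transversal (fun=> 0) bal (leq_trans ms (leqW (leq_addr _ _))).
have bT i := transversal_block i TT.
have bal1 := balanced_remaining bT TR bal; rewrite cardE in bal1.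
have [F [R' [Fok bal' pm Fphi]]] := choose_linkings T (enum_uniq _) bal1 ms phi0.
(* [W] collects the vertex of each [F i] in block [i], which is taken from [R] but is not part of
   the absorber. *)
exists (T, F), [seq F i i | i <- enum I], R'; split=> //.
- apply/and3P; split=> //; apply/forallP=> i /=; first by case/andP: (Fok i (mem_enum _ _)).
  by case/andP: (Fok i (mem_enum _ _)).
- apply: perm_trans (perm_remaining bT TR); rewrite /absorber_verts -catA perm_cat2l.
  apply: perm_trans pm; rewrite catA perm_cat2r perm_catC perm_sym.
  have <- : [seq verts (replace (F i) i ([ffun i => F i i] i)) | i <- enum I] = [seq verts (F i) | i <- enum I].
    apply: eq_map => i; congr verts; apply/ffunP=> j; rewrite !ffunE.
    by case: eqP => [->|].
  have -> : [seq F i i | i <- enum I] = [seq [ffun i => F i i] i | i <- enum I].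
    by apply: eq_map => i; rewrite ffunE.
  exact: perm_replace_all.
- rewrite cardE; apply: leq_trans Fphi _; rewrite leq_mul2l; apply/orP; right.
  rewrite big_mkcond [X in _ <= X]big_mkcond; apply: leq_sum => Z _.
  case: ifP => // /allP H; suff -> : absorbs (T, F) Z by [].
  by apply/forallP=> i; apply: H; rewrite mem_enum.
Qed.

End Selection.
End Absorption.

(** * Perfect tilings *)

(** The first two terms of the binomial expansion both equal [x ^ x]. *)
Lemma expn_succ_ge x : 0 < x -> 2 * x ^ x <= x.+1 ^ x.
Proof.
case: x => // x _; rewrite -[x.+2]addn1 expnDn big_ord_recl /= bin0 mul1n subn0.
rewrite exp1n muln1 mulSn mul1n leq_add2l.
rewrite big_ord_recl /= /bump /= bin1 exp1n muln1 add1n subn1 /= -expnS.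
exact: leq_addr.
Qed.

(** Raised to the power [h.*2], [expn_succ_ge] gives a factor [4 ^ h], half of whose exponent beats
    [N]. *)
Lemma bernoulli_power x m h N :
  0 < x -> x * h.*2 <= m -> N < 2 ^ h ->
  N * 2 ^ h * x ^ m < x.+1 ^ m.
Proof.
move=> x0 xm Nh.
have h1 : 2 ^ h.*2 * x ^ (x * h.*2) <= x.+1 ^ (x * h.*2).
  by rewrite !expnM -expnMn; case: h {xm Nh} => // h; rewrite leq_exp2r // expn_succ_ge.
have h2 : x ^ (m - x * h.*2) <= x.+1 ^ (m - x * h.*2).
  by case: (m - _) => // n; rewrite leq_exp2r.
rewrite -(subnKC xm) !expnD.
apply: leq_trans (leq_mul h1 h2).
rewrite mulnA ltn_pmul2r ?expn_gt0 ?x0 // ltn_pmul2r ?expn_gt0 ?x0 //.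
by rewrite -addnn expnD ltn_pmul2r ?expn_gt0.
Qed.

Section PerfectTiling.
Variables (V I : finType) (e : rel V) (b : V -> I).
Hypotheses (es : symmetric e) (ei : irreflexive e).
Local Notation ffVI := {ffun I -> V}.
Variables (r D a smin q h : nat).
(** [1 / Q] is the weighted proportion of transversals that a chosen absorber is sure to absorb, and
    [m] is the number of absorbers, large enough for [bernoulli_power] with [x = 2 * Q - 1]. *)
Let Q := a ^ #|I|.
Let m := 4 * Q * h.
Hypotheses (I0 : 0 < #|I|) (h0 : 0 < h) (hmin : h <= smin).
Hypothesis deg : forall v, #|nbhd e v| <= D.
Hypothesis Dq : D.*2 + q <= smin.
Hypothesis slack : forall s, smin <= s -> s <= a * (s - D.*2).
Hypothesis bal : balanced b [set: V] r.
Hypothesis room : smin + m * #|I|.+1 <= r.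

Let smin0 : 0 < smin. Proof. exact: leq_trans hmin. Qed.
Let Dsmin : D.*2 <= smin. Proof. exact: leq_trans (leq_addr _ _) Dq. Qed.
Let Q0 : 0 < Q.
Proof.
rewrite expn_gt0; case: a slack => // /(_ smin (leqnn _)).
by rewrite mul0n leqn0 => /eqP s0; move: smin0; rewrite s0.
Qed.

(** Each [Z] has a weight that halves with every absorber that absorbs it. A new absorber reaches a
    proportion [1 / Q] of the total, which is thus multiplied by at most [1 - 1 / (2 * Q)]. *)
Lemma absorbing_sequence t : t <= m ->
  exists (As : seq (absorber V I)) W R,
    [/\ size As = t, all (is_absorber e b) As, balanced b R (r - t * #|I|.+1),
      perm_eq (flatten (map (@absorber_verts V I) As) ++ (W ++ enum R)) (enum [set: V])
    & Q.*2 ^ t * (\sum_Z 2 ^ (m - count (fun A => absorbs e A Z) As))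
       <= Q.*2.-1 ^ t * (#|{: ffVI}| * 2 ^ m)].
Proof.
elim: t => [_|t IH tm].
  exists [::], [::], [set: V]; split=> //=; first by rewrite mul0n subn0.
  by rewrite !expn0 !mul1n subn0 sum_nat_const.
have [As [W [R [sz allA balR pm pot]]]] := IH (ltnW tm).
pose phi Z := 2 ^ (m - count (fun A => absorbs e A Z) As).
have tk : smin + t.+1 * #|I|.+1 <= r.
  by apply: leq_trans room; rewrite leq_add2l leq_mul2r tm orbT.
have phi0 : 0 < \sum_Z phi Z.
  have [T _] := choose_transversal es ei smin0 Dsmin deg (fun=> 0) bal (leq_trans (leq_addr _ _) room).
  by rewrite (bigD1 T) //= addn_gt0 expn_gt0.
have balR' : balanced b R (r - t.+1 * #|I|.+1 + #|I|.+1).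
  by move: balR; congr (balanced b R _); move: tk; rewrite mulSn; lia.
have sm' : smin <= r - t.+1 * #|I|.+1 by move: tk; lia.
have [A [W' [R' [AA balR'' pm' Aphi]]]] := choose_absorber es ei smin0 Dsmin slack deg balR' sm' phi0.
exists (A :: As), (W ++ W'), R'; split=> //=.
- by rewrite sz.
- by rewrite AA.
- apply: perm_trans pm; rewrite -catA perm_catCA perm_cat2l -catA.
  apply: (@perm_trans _ (W ++ (absorber_verts A ++ (W' ++ enum R')))); last by rewrite perm_cat2l.
  by rewrite perm_catCA.
pose phi' Z := 2 ^ (m - (absorbs e A Z + count (fun A => absorbs e A Z) As)).
have half : 2 * (\sum_Z phi' Z) + \sum_(Z | absorbs e A Z) phi Z = 2 * \sum_Z phi Z.
  rewrite [X in _ + X]big_mkcond !big_distrr -big_split; apply: eq_bigr => Z _ /=.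
  have : count (fun A => absorbs e A Z) As < m by rewrite -sz in tm; apply: leq_ltn_trans tm; apply: count_size.
  rewrite /phi' /phi; case: (absorbs e A Z) => /=; last by rewrite addn0.
  move=> lt; set c := count _ _ in lt *.
  have -> : m - c = (m - (1 + c)).+1 by lia.
  by rewrite expnS; lia.
have step : Q.*2 * (\sum_Z phi' Z) <= Q.*2.-1 * (\sum_Z phi Z).
  have : Q * (2 * (\sum_Z phi' Z) + \sum_(Z | absorbs e A Z) phi Z) = Q * (2 * \sum_Z phi Z) by rewrite half.
  rewrite mulnDr -[Q.*2.-1]subn1 mulnBl mul1n !mulnA [Q * 2]muln2; lia.
rewrite expnSr -mulnA.
apply: (@leq_trans (Q.*2 ^ t * (Q.*2.-1 * (\sum_Z phi Z)))); first by rewrite leq_mul2l step orbT.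
by rewrite mulnCA expnS -mulnA leq_mul2l pot orbT.
Qed.

Hypothesis few : #|{: ffVI}| < 2 ^ h.

(** A [Z] absorbed fewer than [h] times would alone weigh more than the final total, by
    [bernoulli_power]. *)
Lemma absorbing_family :
  exists (As : seq (absorber V I)) W R,
    [/\ all (is_absorber e b) As, forall Z, h <= count (fun A => absorbs e A Z) As,
        balanced b R (r - m * #|I|.+1)
      & perm_eq (flatten (map (@absorber_verts V I) As) ++ (W ++ enum R)) (enum [set: V])].
Proof.
have [As [W [R [sz allA balR pm pot]]]] := absorbing_sequence (leqnn _).
exists As, W, R; split=> // Z; rewrite leqNgt; apply/negP=> cZ.
have Q2 : Q.*2 = Q.*2.-1.+1 by rewrite prednK // double_gt0.
have x0 : 0 < Q.*2.-1 by move: Q0; lia.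
have xm : Q.*2.-1 * h.*2 <= m.
  apply: (@leq_trans (Q.*2 * h.*2)); first by rewrite leq_mul2r leq_pred orbT.
  by rewrite /m -!muln2; lia.
have := bernoulli_power x0 xm few; rewrite -Q2 ltnNge => /negP; apply.
rewrite -(leq_pmul2r (expn_gt0 2 m)) //.
have hm : h <= m by rewrite /m leq_pmull // muln_gt0.
have : Q.*2 ^ m * 2 ^ (m - h) <= Q.*2.-1 ^ m * (#|{: ffVI}| * 2 ^ m).
  apply: leq_trans pot; rewrite leq_mul2l; apply/orP; right.
  rewrite (bigD1 Z) //=; apply: leq_trans (leq_addr _ _).
  by rewrite leq_exp2l // leq_sub2l // ltnW.
rewrite -(leq_pmul2r (expn_gt0 2 h)) //.
rewrite -mulnA -expnD subnK // => H; apply: leq_trans H _.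
lia.
Qed.

Hypothesis large : 16 * (r * (#|V| * (7 * r * (#|I| * r) ^ 4))) < (h * q) ^ 4.

Lemma perfect_tiling : tileable e b (enum [set: V]).
Proof.
have [As [W [R [allA cnt balR pm]]]] := absorbing_family.
pose used := flatten (map (@absorber_verts V I) As).
(* [R0] is everything outside the absorbers, so the vertices of [W] return to the pool. *)
pose R0 := [set x | x \notin used].
have uniq_used : uniq used.
  by have := enum_uniq [set: V]; rewrite -(perm_uniq pm) cat_uniq => /andP[].
have pm0 : perm_eq (used ++ enum R0) (enum [set: V]).
  apply: uniq_perm; rewrite ?enum_uniq //.
    rewrite cat_uniq uniq_used enum_uniq andbT /=.
    by apply/hasPn=> x; rewrite mem_enum inE.
  by move=> x; rewrite mem_cat !mem_enum !inE orbN.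
(* Absorbing nothing tiles [used], so the absorbers take equally many vertices from each block and
   [R0] is balanced. *)
have [ts tsT pts] : tileable e b used.
  have := @absorb_all V I e b es ei As [::] allA.
  by rewrite cats0; apply.
have cnt_ts i : count (fun x => b x == i) used = size ts.
  rewrite -(permP pts) count_flatten -map_comp.
  elim: ts tsT {pts} => //= T ts IH /andP[/andP[/forallP bT _] /IH ->]; rewrite -[RHS]add1n; congr (_ + _).
  have <- : count_mem i (enum I) = 1 by rewrite count_uniq_mem ?enum_uniq // mem_enum.
  rewrite /verts codomE count_map.
  by apply: eq_count => j /=; rewrite (eqP (bT j)) .
have cardE (X : {set V}) i : #|[set x in X | b x == i]| = count (fun x => b x == i) (enum X).
  rewrite cardE -size_filter; apply: perm_size; apply: uniq_perm.
  - exact: enum_uniq.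
  - by rewrite filter_uniq // enum_uniq.
  - by move=> x; rewrite mem_enum [RHS]mem_filter mem_enum inE andbC.
pose s0 := r - size ts.
have balR0 : balanced b R0 s0.
  move=> i; rewrite cardE /s0 -(bal i) cardE -(permP pm0) count_cat cnt_ts.
  by rewrite addKn.
have ms0 : smin <= s0.
  have /card_gt0P[i _] := I0.
  have le : #|[set x in R | b x == i]| <= #|[set x in R0 | b x == i]|.
    apply/subset_leq_card/subsetP=> x; rewrite !inE => /andP[xR ->]; rewrite andbT.
    have := enum_uniq [set: V]; rewrite -(perm_uniq pm) cat_uniq => /and3P[_ /hasPn H _].
    by apply: H; rewrite mem_cat mem_enum xR orbT.
  by move: le; rewrite balR balR0; move: room; lia.
have s0r : s0 <= r by apply: leq_subr.
have large0 : 16 * (s0 * (#|V| * (7 * s0 * (#|I| * s0) ^ 4))) < (h * q) ^ 4.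
  apply: leq_ltn_trans large; rewrite leq_mul2l leq_mul // leq_mul2l leq_mul ?orbT //.
    by rewrite leq_mul2l s0r.
  by rewrite leq_exp2r // leq_mul2l s0r orbT.
have deg0 v : #|nbhd e v :&: R0| <= D by apply: deg_in.
have slack0 : D.*2 + q <= s0 by apply: leq_trans ms0.
have [ts' [R' [tsT' balR' pm']]] :=
  almost_tiling es ei balR0 deg0 slack0 h0 large0 (leqnn h) (leq_trans hmin ms0).
have [Zs [szZ bZ pmZ]] := split_transversals balR'.
have t1 : tileable e b (used ++ flatten (map (@verts V I) Zs)).
  by apply: absorb_all => // Z; rewrite szZ.
have t2 : tileable e b (flatten (map (@verts V I) ts')) by exists ts'.
apply: tileable_perm (tileable_cat t1 t2).
apply: perm_trans pm0; rewrite -catA perm_cat2l.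
apply: perm_trans pm'; rewrite perm_catC perm_cat2l.
exact: pmZ.
Qed.
End PerfectTiling.

(** * Strong colourings *)

(** With [j = h %/ (2 * K)], [c * h.+1] is at most [j * j.+1 < 2 ^ (2 * j)]. This compares the
    number of transversals, polynomial in [r], with [2 ^ h]. *)
Lemma power_lt_exp c k : exists h0, forall h, h0 <= h -> (c * h.+1) ^ k < 2 ^ h.
Proof.
case: k => [|k]; first by exists 1 => h h0; rewrite expn0 -[1](expn0 2) ltn_exp2l.
set K := k.+1; exists (2 * K * (2 * K * c)) => h hh.
pose j := h %/ (2 * K).
have K0 : 0 < 2 * K by [].
have hj : h.+1 <= 2 * K * j.+1 by have := ltn_ceil h K0; rewrite -/j mulnC.
have jc : 2 * K * c <= j by rewrite /j leq_divRL // mulnC.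
have lt : c * h.+1 < 2 ^ (2 * j).
  apply: (@leq_ltn_trans (2 * K * c * j.+1)).
    by rewrite [2 * K * c]mulnC -mulnA leq_mul2l hj orbT.
  rewrite [2 * j]mul2n -addnn expnD.
  apply: (@leq_ltn_trans (j * 2 ^ j)); first exact: leq_mul jc (ltn_expl j (ltnSn 1)).
  by rewrite ltn_pmul2r ?expn_gt0 // ltn_expl.
apply: (@leq_trans ((2 ^ (2 * j)) ^ K)); first by rewrite ltn_exp2r.
rewrite -expnM leq_exp2l //; have := leq_trunc_div h (2 * K); rewrite -/j; lia.
Qed.

(* In the situation of interest [a q0] bounds the block size [r], so that the
   slack [q0] in [2 D + q0 <= r] is a fixed proportion of [r]; half of it is
   spent on the absorbers. *)
Lemma perfect_tiling_large (k a : nat) : exists r0, forall (V I : finType) (e : rel V) (b : V -> I) r D q0,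
  symmetric e -> irreflexive e -> #|I| = k -> 0 < k -> balanced b [set: V] r ->
  (forall v, #|nbhd e v| <= D) -> D.*2 + q0 <= r -> r <= a * q0 -> r0 <= r ->
  tileable e b (enum [set: V]).
Proof.
(* [a1] is the slack ratio once half of [q0] is spent, [h * M] is what choosing the absorbers takes
   from each block, and [H] makes [h = r %/ H] satisfy [4 * (h * M) <= q0]. *)
pose a1 := (2 * a).+1; pose Q := a1 ^ k; pose M := 4 * Q * k.+1; pose H := 4 * a * M.
have [h0 h0P] := power_lt_exp (k * H) k.
(* The summands ensure in order [h0 <= h], [0 < h] and the fourth-moment condition, where
   [112 = 16 * 7]. *)
exists (H * h0 + H + 112 * k ^ 5 * (4 * H * a) ^ 4 + 1)%N => V I e b r D q0 es ei Ik k0 bal deg Dq ra r0r.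
have r_gt0 : 0 < r by move: r0r; lia.
have a0 : 0 < a by move: ra; case: (a) => //; lia.
have q00 : 0 < q0 by move: ra; case: (q0) => //; lia.
have Q0 : 0 < Q by rewrite expn_gt0.
have M0 : 0 < M by rewrite !muln_gt0 Q0.
have H0 : 0 < H by rewrite /H muln_gt0 M0 muln_gt0 a0.
pose h := r %/ H; pose smin := r - q0./2; pose q := q0 - q0./2.
have hr : h * H <= r by apply: leq_trunc_div.
have rh : r < h.+1 * H by apply: ltn_ceil.
have h0h : h0 <= h by rewrite leq_divRL // mulnC; move: r0r; lia.
have h_gt0 : 0 < h by rewrite divn_gt0 //; move: r0r; lia.
have hM : 4 * (h * M) <= q0.
  rewrite -(leq_pmul2l a0); apply: leq_trans ra; apply: leq_trans hr.
  by rewrite /H; lia.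
have hM2 : h * M <= q0./2 by lia.
have hleM : h <= h * M by rewrite leq_pmulr.
have q02 : q0 <= 2 * q by rewrite /q; lia.
have Ds : D.*2 + q <= smin by rewrite /smin /q; clear -Dq; lia.
have sl s : smin <= s -> s <= a1 * (s - D.*2).
  move=> ms; have D2s : D.*2 <= s by apply: leq_trans ms; apply: leq_trans Ds; apply: leq_addr.
  have qs : q <= s - D.*2 by rewrite leq_subRL //; apply: leq_trans ms.
  have aq : a * q0 <= 2 * a * (s - D.*2).
    rewrite [2 * a]mulnC -mulnA leq_mul2l; apply/orP; right.
    by apply: leq_trans q02 _; rewrite leq_mul2l qs orbT.
  rewrite /a1 mulSn -{1}(subnK D2s) leq_add2l.
  exact: leq_trans (leq_trans (leq_addr q0 _) Dq) (leq_trans ra aq).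
have cVI : #|V| = k * r.
  have -> : #|V| = \sum_(i : I) #|[set x in [set: V] | b x == i]|.
    rewrite -sum1_card (partition_big b xpredT) //=; apply: eq_bigr => i _.
    by rewrite sum1dep_card; apply: eq_card => x; rewrite !inE.
  by rewrite (eq_bigr (fun=> r)) ?sum_nat_const ?Ik //; move=> i _; apply: bal.
apply: (@perfect_tiling V I e b es ei r D a1 smin q h) => //.
- by rewrite Ik.
- by rewrite /smin; lia.
- rewrite Ik -/Q; have -> : 4 * Q * h * k.+1 = h * M by rewrite /M; lia.
  by rewrite /smin; lia.
- rewrite card_ffun Ik cVI; apply: leq_ltn_trans (h0P _ h0h).
  by rewrite leq_exp2r // -mulnA leq_mul2l [H * _]mulnC ltnW // orbT.
- rewrite Ik cVI.
  have rr : r ^ 2 <= h * q * (4 * H * a).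
    have h1 : r <= 2 * H * h by move: rh (leq_mul h_gt0 (leqnn H)); lia.
    have h2 : r <= 2 * a * q.
      by apply: leq_trans ra _; rewrite [2 * a]mulnC -mulnA leq_mul2l q02 orbT.
    by rewrite -mulnn; apply: leq_trans (leq_mul h1 h2) _; apply/eq_leq; ring.
  have r8 : r ^ 8 <= (h * q) ^ 4 * (4 * H * a) ^ 4.
    by rewrite -expnMn -[8]/(2 * 4) expnM leq_exp2r.
  rewrite -(ltn_pmul2r (m := (4 * H * a) ^ 4)); last first.
    by rewrite expn_gt0 muln_gt0 a0 muln_gt0 H0.
  apply: leq_trans r8.
  have -> : 16 * (r * (k * r * (7 * r * (k * r) ^ 4))) = 112 * k ^ 5 * r ^ 7.
    by rewrite expnMn; ring.
  have -> : r ^ 8 = r * r ^ 7 by rewrite -expnS.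
  rewrite mulnAC ltn_pmul2r ?expn_gt0 ?r_gt0 //; move: r0r; lia.
Qed.

Lemma find_class (V I : finType) (ts : seq {ffun I -> V}) T0 x c :
  uniq (flatten (map (@verts V I) ts)) -> c < size ts -> x \in verts (nth T0 ts c) ->
  find (fun T => x \in verts T) ts = c.
Proof.
elim: ts c => //= T ts IH c; rewrite cat_uniq => /and3P[_ dis un].
case: c => [|c] /= csz xin; first by rewrite xin.
rewrite (IH c) //; case: ifP => // xT.
move/hasPn: dis => /(_ x); rewrite xT => H; suff : x \in flatten (map (@verts V I) ts) by move/H.
by apply/flattenP; exists (verts (nth T0 ts c)) => //; apply/map_f/mem_nth.
Qed.

Definition blocks_colourable (k a r0 : nat) : Prop :=
  forall (V : finType) (e : rel V) r D q0 (P : {set {set V}}),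
  simple_graph e -> (forall v, degree e v <= D) -> D.*2 + q0 <= r -> r <= a * q0 -> r0 < r ->
  partition P [set: V] -> {in P, forall B : {set V}, #|B| = r} -> #|P| = k ->
  exists f : V -> 'I_r,
      (forall x y : V, e x y -> f x != f y) /\
      {in P, forall B : {set V}, forall i : 'I_r, exists2 x, x \in B & f x = i}.

(** The colour of a vertex is the index of the independent transversal containing it; counting shows
    that there are [r] of these. *)
Lemma strong_colouring_blocks (k a : nat) : exists r0, blocks_colourable k a r0.
Proof.
have [r0 r0P] := perfect_tiling_large k a.
exists r0 => V e r D q0 P [es ei] deg Dq ra r0r partP Pr Pk.
have r_gt0 : 0 < r by apply: leq_ltn_trans r0r.
have /and3P[/eqP cov triv _] := partP.
have inP v : pblock P v \in P by apply: pblock_mem; rewrite cov.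
have [k0|k0] := posnP k.
  have noV (v : V) : False by have := inP v; rewrite (cards0_eq (etrans Pk k0)) inE.
  by exists (fun=> Ordinal r_gt0); split=> [x|B BP]; [case: (noV x) | move: BP; rewrite (cards0_eq (etrans Pk k0)) inE].
pose I : finType := {B : {set V} | B \in P}.
pose b v : I := Sub (pblock P v) (inP v).
have bE v (i : I) : (b v == i) = (v \in val i).
  rewrite -val_eqE /=; apply/eqP/idP => [<-|vi]; first by rewrite mem_pblock cov.
  by apply: def_pblock => //; apply: (valP i).
have Ik : #|I| = k by rewrite card_sig -Pk; apply: eq_card.
have bal : balanced b [set: V] r.
  by move=> i; rewrite -(Pr _ (valP i)); apply: eq_card => v; rewrite !inE bE.
(* Edges inside a class are dropped; their ends get distinct colours since each tile meets a class
   once. *)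
pose e' x y := e x y && (b x != b y).
have es' : symmetric e' by move=> x y; rewrite /e' es eq_sym.
have ei' : irreflexive e' by move=> x; rewrite /e' ei.
have deg' v : #|nbhd e' v| <= D.
  apply: leq_trans (deg v); apply/subset_leq_card/subsetP=> x.
  by rewrite !inE => /andP[].
have [ts tsT pm] := r0P V I e' b r D q0 es' ei' Ik k0 bal deg' Dq ra (ltnW r0r).
have bT T i : T \in ts -> b (T i) = i by move=> /(allP tsT)/andP[/forallP/(_ i)/eqP].
have un : uniq (flatten (map (@verts V I) ts)) by rewrite (perm_uniq pm) enum_uniq.
have szts : size ts = r.
  have cV : #|V| = k * r by rewrite -Pk -cardsT; apply: card_uniform_partition.
  have := perm_size pm; rewrite -cardE cardsT cV size_flatten /shape -map_comp.
  rewrite (eq_map (g := fun=> k)) => [|T]; last by rewrite /= size_codom Ik.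
  have -> : sumn [seq k | _ <- ts] = k * size ts by elim: (ts) => [|T ts' /= ->]; rewrite ?muln0 ?mulnS.
  by move/eqP; rewrite eqn_pmul2l // => /eqP.
have hasc v : has (fun T : {ffun I -> V} => v \in verts T) ts.
  have : v \in flatten (map (@verts V I) ts) by rewrite (perm_mem pm) mem_enum inE.
  by case/flattenP=> _ /mapP[T Tts ->] vT; apply/hasP; exists T.
have fr v : find (fun T : {ffun I -> V} => v \in verts T) ts < r by rewrite -szts -has_find.
pose f v := Ordinal (fr v); exists f; split.
- move=> x y xy; apply/eqP=> /(congr1 val) /= fxy.
  pose T0 : {ffun I -> V} := nth [ffun=> x] ts (find (fun T : {ffun I -> V} => x \in verts T) ts).
  have xT : x \in verts T0 by apply: (nth_find [ffun=> x] (hasc x)).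
  have yT : y \in verts T0 by rewrite /T0 fxy; apply: (nth_find [ffun=> x] (hasc y)).
  have T0ts : T0 \in ts by apply: mem_nth; rewrite szts.
  case/codomP: xT => i xi; case/codomP: yT => j yj.
  have /andP[_ /forallP/(_ i)/forallP/(_ j)] := allP tsT _ T0ts.
  rewrite -xi -yj /e' xy /= negbK => /eqP bxy.
  by move: xy; rewrite xi yj; move: bxy; rewrite {1}xi {1}yj !bT // => ->; rewrite ei.
- move=> B BP c; pose i : I := Sub B BP.
  have Tts (T0 : {ffun I -> V}) : nth T0 ts c \in ts by apply: mem_nth; rewrite szts.
  have [x xB] : exists x, x \in B by apply/card_gt0P; rewrite Pr.
  pose T := nth [ffun=> x] ts c.
  exists (T i); first by have := bE (T i) i; rewrite (bT _ _ (Tts _)) eqxx => <-.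
  apply: val_inj => /=; apply: (find_class (T0 := [ffun=> x]) un); first by rewrite szts.
  by apply/codomP; exists i.
Qed.

(** A bound on [#|V| / r] leaves finitely many values of [#|P|], whose thresholds are merged by a
    maximum. *)
Lemma strong_colouring_bounded (K a : nat) : exists r0, forall (V : finType) (e : rel V) r D q0,
  simple_graph e -> (forall v, degree e v <= D) -> D.*2 + q0 <= r -> r <= a * q0 -> r0 < r ->
  #|V| <= K * r -> strongly_col_div e r.
Proof.
have [r0 r0P] : exists r0, forall k, k <= K -> blocks_colourable k a r0.
  elim: K => [|K [r1 IH]].
    have [r0 r0P] := strong_colouring_blocks 0 a.
    by exists r0 => k; rewrite leqn0 => /eqP->.
  have [r0 r0P] := strong_colouring_blocks K.+1 a.
  exists (maxn r0 r1) => k kK V e r D q0 P sg deg Dq ra; rewrite gtn_max => /andP[r0r r1r].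
  move: kK; rewrite leq_eqVlt => /orP[/eqP->|kK]; first exact: (r0P V e r D q0 P).
  exact: (IH k kK V e r D q0 P).
exists r0 => V e r D q0 sg deg Dq ra r0r VK P partP Pr.
have r_gt0 : 0 < r by apply: leq_ltn_trans r0r.
apply: (r0P #|P| _ V e r D q0 P) => //.
by rewrite -(leq_pmul2r r_gt0) -(card_uniform_partition Pr partP) cardsT.
Qed.

Lemma pad_rel_simple (V : finType) (e : rel V) k : simple_graph e -> simple_graph (pad_rel V e k).
Proof. by case=> es ei; split=> [[x|x] [y|y]|[x|x]] //=. Qed.

Lemma pad_rel_degree (V : finType) (e : rel V) k D :
  (forall v, degree e v <= D) -> forall v, degree (pad_rel V e k) v <= D.
Proof.
move=> deg [v|v]; last first.
  by rewrite /degree (_ : [set y | _] = set0) ?cards0 //; apply/setP=> -[y|y]; rewrite !inE.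
apply: leq_trans (deg v); rewrite /degree -(card_imset _ (@inl_inj V 'I_k)).
apply/subset_leq_card/subsetP=> -[y|y]; rewrite inE //= => vy.
by apply: imset_f; rewrite inE.
Qed.

Lemma strongly_colourable_dense (C p : nat) : 0 < p -> exists n0, forall (V : finType) (e : rel V),
  simple_graph e -> n0 <= #|V| -> #|V| <= C * max_degree e ->
  let r := (max_degree e).*2 + max_degree e %/ p in 0 < r /\ strongly_colourable e r.
Proof.
(* Padding adds fewer than [r] vertices, hence [C.+1]; and [D < 2 * p * q0] gives
   [r <= (4 * p).+1 * q0]. *)
move=> p0; have [r0 r0P] := strong_colouring_bounded C.+1 (4 * p).+1.
(* This forces [r0 + p < D], hence [0 < D %/ p]; the successor excludes [C = 0]. *)
exists (C * (r0 + p)).+1 => V e sg nV VC.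
set D := max_degree e in VC *; set q0 := D %/ p; move=> r.
have Dbig : r0 + p < D.
  by move: (leq_trans nV VC); case: (C) => // C'; rewrite ltn_pmul2l.
have q00 : 0 < q0 by rewrite divn_gt0 // ltnW // (leq_ltn_trans (leq_addl r0 p)).
have Dr : D <= r by rewrite /r -addnn -addnA leq_addr.
have r_gt0 : 0 < r by apply: leq_trans Dr; apply: leq_trans Dbig.
have ra : r <= (4 * p).+1 * q0.
  have : D < q0.+1 * p by apply: ltn_ceil.
  have : p <= q0 * p by rewrite leq_pmull.
  rewrite mulSn -/q0 mulSn /r; lia.
have r0r : r0 < r by apply: leq_trans Dr; apply: leq_ltn_trans Dbig; apply: leq_addr.
have deg v : degree e v <= D by apply: (@leq_bigmax _ (degree e)).
have VCr : #|V| <= C * r by apply: leq_trans VC _; rewrite leq_mul2l Dr orbT.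
split=> //; rewrite /strongly_colourable; case: ifP => _.
  by apply: (r0P _ _ _ D q0) => //; apply: leq_trans VCr _; rewrite leq_mul2r leqnSn orbT.
apply: (r0P _ _ _ D q0) => //; [exact: pad_rel_simple | exact: pad_rel_degree |].
rewrite card_sum card_ord /pad_count mulSn.
have : r * ((#|V| + r.-1) %/ r) <= #|V| + r.-1 by rewrite mulnC leq_trunc_div.
by move: VCr r_gt0; lia.
Qed.

Theorem theorem1p3 :
  forall c eps : R, Rlt R0 c -> Rlt R0 eps ->
  exists n0 : nat,
    forall (V : finType) (e : rel V),
      simple_graph e ->
      n0 <= #|V| ->
      Rle (Rmult c (INR #|V|)) (INR (max_degree e)) ->
      exists r : nat,
        0 < r /\
        Rle (INR r) (Rmult (Rplus (Rplus R1 R1) eps) (INR (max_degree e))) /\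
        strongly_colourable e r.
Proof.
move=> c eps c0 eps0.
(* [1 / c < C] turns the density hypothesis into [#|V| <= C * D]; [1 / eps < p] makes the extra
   [D %/ p] colours at most [eps * D]. *)
have [C HC] := INR_unbounded (Rinv c); have [p Hp] := INR_unbounded (Rinv eps).
have p0 : 0 < p.
  case: p Hp => //= H; have := Rinv_0_lt_compat _ eps0; Lra.lra.
have [n0 n0P] := strongly_colourable_dense C p0.
exists n0 => V e sg nV cV; set D := max_degree e in cV *.
have VC : #|V| <= C * D.
  apply/ssrnat.leP; apply: INR_le; rewrite mult_INR.
  rewrite -[INR #|V|]Rmult_1_l -(Rinv_l c) ?Rmult_assoc; last by apply: Rgt_not_eq.
  apply: Rle_trans (Rmult_le_compat_l _ _ _ _ cV) _; first by left; apply: Rinv_0_lt_compat.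
  by apply: Rmult_le_compat_r; [apply: pos_INR | left].
have [r0 rs] := n0P V e sg nV VC.
exists (D.*2 + D %/ p); split=> //; split=> //.
have qD : Rle (Rmult (INR (D %/ p)) (INR p)) (INR D).
  by rewrite -mult_INR; apply/le_INR/ssrnat.leP; apply: leq_trunc_div.
have pe : Rle (IZR 1) (Rmult (INR p) eps).
  rewrite -(Rinv_l eps); last by apply: Rgt_not_eq.
  by apply: Rmult_le_compat_r; left.
have q_le : Rle (INR (D %/ p)) (Rmult eps (INR D)).
  have := Rmult_le_compat_l _ _ _ (pos_INR (D %/ p)) pe.
  have := Rmult_le_compat_l _ _ _ (Rlt_le _ _ eps0) qD.
  Lra.lra.
rewrite -addnn !plus_INR; Lra.lra.
Qed.
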